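(* We have \[ r^\pm=\pm r+(\mathrm{id}\otimes\theta)r_{21},\qquad\kappa^{\mathrm{core}}=\mu\bigl((\mathrm{id}\otimes\theta)r_{21}\bigr)+\frac14\sum_{\lambda\in\Sigma}\Bigl(\frac{1+\xi_{2\lambda}}{1-\xi_{2\lambda}}\Bigr)\mathrm{mtp}(\lambda)t_\lambda, \] with \[ r=-\frac12\varpi_{\mathfrak{m}}-\frac12\sum_{j=1}^rx_j\otimes x_j-\sum_{\lambda\in\Sigma}\frac{\varpi_\lambda}{1-\xi_{-2\lambda}}\in(\mathcal{R}\otimes(\mathfrak{g}\otimes\mathfrak{g})^M)^W . \] Furthermore, $(\mathrm{id}\otimes\theta)r_{21}=(\theta\otimes\mathrm{id})r$.
   Context: Let $G$ be a connected real semisimple Lie group with finite center and Lie algebra $\mathfrak{g}_{\mathbb{R}}$. Fix a Cartan involution $\theta_{\mathbb{R}}$ of $\mathfrak{g}_{\mathbb{R}}$, with Cartan decomposition $\mathfrak{g}_{\mathbb{R}}=\mathfrak{k}_{\mathbb{R}}\oplus\mathfrak{p}_{\mathbb{R}}$ into $(+1)$- and $(-1)$-eigenspaces, and a maximal abelian subspace $\mathfrak{a}_{\mathbb{R}}\subset\mathfrak{p}_{\mathbb{R}}$ of dimension $r$. Omitting the subscript $\mathbb{R}$ denotes complexification; $\theta$ is the complex linear extension of $\theta_{\mathbb{R}}$ and $B$ is the Killing form of $\mathfrak{g}$. Fix a basis $\{x_1,\ldots,x_r\}$ of $\mathfrak{a}_{\mathbb{R}}$, orthonormal with respect to $(x,y):=-B(x,\theta_{\mathbb{R}}(y))$.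 Let $K\subset G$ be the connected Lie subgroup with Lie algebra $\mathfrak{k}_{\mathbb{R}}$, $A=\exp(\mathfrak{a}_{\mathbb{R}})$ with $\log:A\to\mathfrak{a}_{\mathbb{R}}$ the inverse of $\exp$, $M:=Z_K(A)$, $\mathfrak{m}_{\mathbb{R}}:=Z_{\mathfrak{k}_{\mathbb{R}}}(\mathfrak{a}_{\mathbb{R}})$ and $W:=N_K(A)/M$. Let $\Sigma\subset\mathfrak{a}_{\mathbb{R}}^*\setminus\{0\}$ be the restricted root system. For $\lambda\in\mathfrak{a}^*$ write $\xi_\lambda(a)=e^{\lambda(\log a)}$; $A_{\mathrm{reg}}:=\{a\in A:\xi_\lambda(a)\neq1\ \forall\lambda\in\Sigma\}$; $\mathcal{R}$ is the unital subalgebra of $C^\infty(A_{\mathrm{reg}})$ generated by $(1\pm\xi_\lambda)^{-1}$ ($\lambda\in\Sigma$). $W$ acts on $\mathcal{R}$ by $w\xi_\lambda=\xi_{w\lambda}$, on $(\mathfrak{g}\otimes\mathfrak{g})^M$ and $U(\mathfrak{g})^M$ via $\mathrm{Ad}$, and diagonally on tensor products with $\mathcal{R}$. Fix a maximal abelian subspace $\mathfrak{t}_{\mathbb{R}}\subset\mathfrak{m}_{\mathbb{R}}$; $\mathfrak{h}=\mathfrak{t}\oplus\mathfrak{a}$ is a Cartan subalgebra of $\mathfrak{g}$ with root system $R$. For $\alpha\in R$ let $h_\alpha\in\mathfrak{h}$ be defined by $B(h,h_\alpha)=\alpha(h)$ for $h\in\mathfrak{h}$, and choose root vectors $e_\alpha$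 with $[e_\alpha,e_{-\alpha}]=h_\alpha$. For $\lambda\in\Sigma$: $R_\lambda:=\{\alpha\in R:\alpha|_{\mathfrak{a}_{\mathbb{R}}}=\lambda\}$, $\mathrm{mtp}(\lambda):=\#R_\lambda$, $\varpi_\lambda:=\sum_{\alpha\in R_\lambda}e_{-\alpha}\otimes e_\alpha$, and $t_\lambda\in\mathfrak{a}$ is defined by $B(t_\lambda,h)=\lambda(h)$ for $h\in\mathfrak{a}$. $\Omega=\sum_sb_sb_s'$ is the Casimir element ($\{b_s\},\{b_s'\}$ bases of $\mathfrak{g}$ dual with respect to $B$); $\varpi_{\mathfrak{m}}:=\sum_sc_s\otimes c_s'$ for bases $\{c_s\},\{c_s'\}$ of $\mathfrak{m}$ dual with respect to $B|_{\mathfrak{m}\times\mathfrak{m}}$. $\mathrm{pr}_{\mathfrak{k}}=\frac12(\mathrm{id}+\theta)$, $\mathrm{pr}_{\mathfrak{p}}=\frac12(\mathrm{id}-\theta)$; $\mu$ is the multiplication map of $U(\mathfrak{g})$; $X_{21}$ is $X$ with its two tensor components interchanged. Define \[ r^+:=-\varpi_{\mathfrak{m}}-\sum_{\lambda\in\Sigma}\frac{2(\mathrm{pr}_{\mathfrak{k}}\otimes\mathrm{id})(\varpi_\lambda)}{1-\xi_{-2\lambda}},\qquad r^-:=\sum_{j=1}^rx_j\otimes x_j+\sum_{\lambda\in\Sigma}\frac{2(\mathrm{pr}_{\mathfrak{p}}\otimes\mathrm{id})(\varpi_\lambda)}{1-\xi_{-2\lambda}}, \] and $\kappa^{\mathrm{core}}:=\frac12\Omega+\mu(r_{21}^+)\in(\mathcal{R}\otimes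 U(\mathfrak{g})^M)^W$. *)

(* Defs.v *)
From HB Require Import structures.
From mathcomp Require Import all_boot all_order all_algebra.
From mathcomp Require Import finmap complex lra.
From mathcomp Require Import all_classical all_reals all_analysis.

Set Implicit Arguments.
Unset Strict Implicit.
Unset Printing Implicit Defensive.

Import Order.TTheory GRing.Theory Num.Theory.
Import numFieldNormedType.Exports.
Import VectorInternalTheory.

Local Open Scope classical_set_scope.
Local Open Scope complex_scope.
Local Open Scope ring_scope.

HB.mixin Record Vector_isLie (K : fieldType) L of Vector K L := {
  lie : L -> L -> L;
  lie_linearl : forall y, linear (lie^~ y);
  lie_linearr : forall x, linear (lie x);
  lie_alt : forall x, lie x x = 0;
  lie_jacobi : forall x y z, lie x (lie y z) + lie y (lie z x) + lie z (lie x y) = 0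
}.

#[short(type="lieAlgType")]
HB.structure Definition LieAlgebra (K : fieldType) :=
  {L of Vector_isLie K L & Vector K L}.

Section LieTheory.
Variables (K : fieldType) (L : lieAlgType K).
Implicit Types (U V I : {vspace L}) (x y : L).

HB.instance Definition _ x :=
  GRing.isLinear.Build K L L _ (lie x) (lie_linearr x).

Lemma lieDl x y z : lie (x + y) z = lie x z + lie y z.
Proof. by have := lie_linearl z 1 x y; rewrite !scale1r. Qed.

Lemma lieZl a x z : lie (a *: x) z = a *: lie x z.
Proof.
have lie0 : lie 0 z = 0.
  by apply/(addrI (lie 0 z)); rewrite -lieDl !addr0.
by have := lie_linearl z a x 0; rewrite lie0 !addr0.
Qed.

Lemma lieDr x y z : lie x (y + z) = lie x y + lie x z.
Proof. exact: linearD. Qed.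

Lemma lieZr a x z : lie x (a *: z) = a *: lie x z.
Proof. exact: linearZ. Qed.

Lemma lieNl x z : lie (- x) z = - lie x z.
Proof. by rewrite -scaleN1r lieZl scaleN1r. Qed.

Lemma lieNr x z : lie x (- z) = - lie x z.
Proof. exact: linearN. Qed.

Lemma lieC x y : lie x y = - lie y x.
Proof.
apply/eqP; rewrite -addr_eq0; have := lie_alt (x + y).
by rewrite lieDl !lieDr !lie_alt add0r addr0 => ->.
Qed.

Definition ad x : 'End(L) := linfun (lie x).

Lemma adE x y : ad x y = lie x y.
Proof. exact: lfunE. Qed.

Definition killing x y : K := \tr (f2mx (ad x \o ad y)%VF).

Definition abelian_sub U : Prop := {in U &, forall x y, lie x y = 0}.

Definition lie_ideal I : Prop := forall x y, y \in I -> lie x y \in I.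

Definition derived_sub U : {vspace L} :=
  <<[seq lie x y | x <- vbasis U, y <- vbasis U]>>%VS.

Definition solvable_sub U : Prop := exists n, iter n derived_sub U = 0%VS.

Definition semisimple : Prop :=
  forall I, lie_ideal I -> solvable_sub I -> I = 0%VS.

Definition maximal_abelian_in U V : Prop :=
  [/\ (U <= V)%VS, abelian_sub U
    & forall U', (U <= U')%VS -> (U' <= V)%VS -> abelian_sub U' -> U' = U].

Definition centralizer_in U V : {vspace L} :=
  (U :&: \bigcap_(y <- vbasis V) lker (ad y))%VS.

Lemma centralizer_inP U V x :
  reflect (x \in U /\ forall y, y \in V -> lie y x = 0)
    (x \in centralizer_in U V).
Proof.
have memP : reflect (forall y, y \in V -> lie y x = 0)
    (x \in \bigcap_(y <- vbasis V) lker (ad y))%VS.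
  rewrite memvE big_tnth; apply: (iffP subv_bigcapP) => H.
    move=> y /coord_vbasis ->.
    rewrite lieC linear_sum big1 ?oppr0 // => k _; rewrite linearZ /= lieC.
    have := H (cast_ord (esym (size_tuple _)) k) isT.
    rewrite -memvE memv_ker adE => /eqP; rewrite (tnth_nth 0) /= => ->.
    by rewrite oppr0 scaler0.
  move=> k _; rewrite -memvE memv_ker adE; apply/eqP/H.
  exact/vbasis_mem/mem_tnth.
by rewrite memv_cap; apply: (iffP andP) => -[? /memP].
Qed.

Definition lie_endo (f : 'End(L)) : Prop :=
  forall x y, f (lie x y) = lie (f x) (f y).

Definition dual U := 'Hom(subvs_of U, K^o).

Definition weight_vector U (l : dual U) x : Prop :=
  x != 0 /\ forall h : subvs_of U, lie (vsval h) x = (l h : K) *: x.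

(* The roots with respect to U, as functionals on U; sums over the (finite) set
   of roots are finitely supported sums over a set. *)
Definition roots U : set (dual U) :=
  [set l | l != 0 /\ exists x, weight_vector l x].

Definition dual_bases n U (b b' : n.-tuple L) : Prop :=
  [/\ basis_of U b, basis_of U b'
    & forall i j, killing (tnth b i) (tnth b' j) = (i == j)%:R].

End LieTheory.

Arguments roots {K L} U.

(* L (x) L is the space of square matrices, x (x) y having the entries
   x_i * y_j, where the x_i are the coordinates of x in a fixed basis of L. *)
Section Tensor.
Variables (K : fieldType) (L : lieAlgType K).

Definition tensor := 'M[K]_(dim L).

Definition tens (x y : L) : tensor := (v2r x)^T *m v2r y.

Definition tens_map (f g : 'End(L)) (T : tensor) : tensor :=
  (f2mx f)^T *m T *m f2mx g.

Definition tens_swap (T : tensor) : tensor := T^T.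

Definition coord_vec (i : 'I_(dim L)) : L := r2v (delta_mx 0 i).

Lemma v2r_lfun (f : 'End(L)) x : v2r (f x) = v2r x *m f2mx f.
Proof. by rewrite unlock /fun_of_lfun_def /= r2vK. Qed.

Lemma tens_mapE f g x y : tens_map f g (tens x y) = tens (f x) (g y).
Proof. by rewrite /tens_map /tens !v2r_lfun trmx_mul !mulmxA. Qed.

Lemma tens_swapE x y : tens_swap (tens x y) = tens y x.
Proof. by rewrite /tens_swap /tens trmx_mul trmxK. Qed.

End Tensor.

Section Enveloping.
Variables (K : fieldType) (L : lieAlgType K).

Definition lie_to_alg (A : algType K) (f : L -> A) : Prop :=
  forall x y, f (lie x y) = f x * f y - f y * f x.

Definition universal_enveloping (U : algType K) (i : {linear L -> U}) : Prop :=
  lie_to_alg i /\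
  forall (A : algType K) (f : {linear L -> A}), lie_to_alg f ->
    exists F : {lrmorphism U -> A}, (forall x, F (i x) = f x) /\
      forall F' : {lrmorphism U -> A}, (forall x, F' (i x) = f x) -> F' =1 F.

Definition mult_map (U : algType K) (i : {linear L -> U}) (T : tensor L) : U :=
  \sum_j \sum_k T j k *: (i (coord_vec j) * i (coord_vec k)).

Lemma mult_mapE (U : algType K) (i : {linear L -> U}) x y :
  mult_map i (tens x y) = i x * i y.
Proof.
have dec z : z = \sum_j v2r z 0 j *: coord_vec j.
  rewrite -[LHS]v2rK {1}[v2r z]row_sum_delta linear_sum.
  by apply: eq_bigr => j _; rewrite linearZ.
rewrite {2}[x]dec {2}[y]dec !linear_sum mulr_suml; apply: eq_bigr => j _.
rewrite mulr_sumr; apply: eq_bigr => k _.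
by rewrite !linearZ /= -scalerAl -scalerAr scalerA !mxE big_ord1 !mxE.
Qed.

End Enveloping.

(* (x, y) stands for x + 'i y. *)
Definition cplx (R : rcfType) (L : lieAlgType R) : Type := (L * L)%type.

Section Complexification.
Variables (R : rcfType) (L : lieAlgType R).
Local Notation LC := (cplx L).

HB.instance Definition _ := GRing.Zmodule.copy LC (L * L)%type.

Definition cplx_scale (c : R[i]) (z : LC) : LC :=
  let: a +i* b := c in (a *: z.1 - b *: z.2, a *: z.2 + b *: z.1).

Fact cplx_scaleA a b z : cplx_scale a (cplx_scale b z) = cplx_scale (a * b) z.
Proof.
case: a b z => [a1 a2] [b1 b2] [x y]; congr pair => /=;
  rewrite !(scalerDr, scalerDl, scalerN, scaleNr, scalerA, opprD);
  by rewrite -!addrA; congr (_ + _); rewrite addrA addrC.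
Qed.

Fact cplx_scale1 : left_id 1 cplx_scale.
Proof. by case=> x y; rewrite /cplx_scale /= !scale1r !scale0r subr0 addr0. Qed.

Fact cplx_scaleDr : right_distributive cplx_scale +%R.
Proof.
move=> [a b] [x y] [x' y']; congr pair => /=; rewrite !scalerDr ?opprD;
  exact: addrACA.
Qed.

Fact cplx_scaleDl z : {morph cplx_scale^~ z : a b / a + b}.
Proof.
case: z => x y [a b] [a' b']; congr pair => /=; rewrite !scalerDl ?opprD;
  exact: addrACA.
Qed.

HB.instance Definition _ := GRing.Zmodule_isLmodule.Build R[i] LC
  cplx_scaleA cplx_scale1 cplx_scaleDr cplx_scaleDl.

Definition cplx_v2r (z : LC) : 'rV[R[i]]_(dim L) :=
  \row_j (v2r z.1 0 j +i* v2r z.2 0 j).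

Fact cplx_v2r_linear : linear cplx_v2r.
Proof.
move=> [a b] [x y] [x' y']; apply/rowP=> j; rewrite !mxE /=.
rewrite !linearD !linearN !linearZ /= !mxE.
by rewrite mulrN.
Qed.

Fact cplx_v2r_bij : bijective cplx_v2r.
Proof.
exists (fun u =>
  (r2v (map_mx (@complex.Re R) u), r2v (map_mx (@complex.Im R) u)) : LC).
  by move=> [x y]; congr pair; apply: v2r_inj; rewrite r2vK;
    apply/rowP=> j; rewrite !mxE.
move=> u; apply/rowP=> j; rewrite !mxE /= !r2vK !mxE.
by case: (u 0 j).
Qed.

Definition cplx_vector_axiom : Vector.axiom (dim L) LC.
Proof. exists cplx_v2r; [exact: cplx_v2r_linear|exact: cplx_v2r_bij]. Defined.

HB.instance Definition _ :=
  Lmodule_hasFinDim.Build R[i] LC cplx_vector_axiom.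

Definition cplx_lie (z w : LC) : LC :=
  (lie z.1 w.1 - lie z.2 w.2, lie z.1 w.2 + lie z.2 w.1).

Local Notation lieE := (lieDl, lieDr, lieZl, lieZr, lieNl, lieNr).

Fact cplx_lie_linearl w : linear (cplx_lie^~ w).
Proof.
case: w => x y [a b] [x1 y1] [x2 y2]; congr pair;
  apply/v2r_inj/rowP => j /=; rewrite !lieE !linearE /= !mxE; lra.
Qed.

Fact cplx_lie_linearr z : linear (cplx_lie z).
Proof.
case: z => x y [a b] [x1 y1] [x2 y2]; congr pair;
  apply/v2r_inj/rowP => j /=; rewrite !lieE !linearE /= !mxE; lra.
Qed.

Fact cplx_lie_alt z : cplx_lie z z = 0.
Proof.
case: z => x y; congr pair => /=; first by rewrite !lie_alt subr0.
by rewrite [lie y x]lieC subrr.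
Qed.

Fact cplx_lie_jacobi x y z : cplx_lie x (cplx_lie y z) +
  cplx_lie y (cplx_lie z x) + cplx_lie z (cplx_lie x y) = 0.
Proof.
have J (a b c : L) j : v2r (lie a (lie b c)) 0 j + v2r (lie b (lie c a)) 0 j +
    v2r (lie c (lie a b)) 0 j = 0.
  by have /(congr1 v2r)/rowP/(_ j) := lie_jacobi a b c; rewrite !linearD linear0 !mxE.
case: x y z => [x1 x2] [y1 y2] [z1 z2]; congr pair;
  apply/v2r_inj/rowP => j /=; rewrite !lieE !linearE /= ?linearN !mxE.
- move: (J x1 y1 z1 j) (J x1 y2 z2 j) (J x2 y1 z2 j) (J x2 y2 z1 j); lra.
- move: (J x1 y1 z2 j) (J x1 y2 z1 j) (J x2 y1 z1 j) (J x2 y2 z2 j); lra.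
Qed.

HB.instance Definition _ := Vector_isLie.Build R[i] LC
  cplx_lie_linearl cplx_lie_linearr cplx_lie_alt cplx_lie_jacobi.

Definition cplx_of (x : L) : LC := (x, 0).

Definition cplx_map (f : 'End(L)) (z : LC) : LC := (f z.1, f z.2).

Fact cplx_map_linear f : linear (cplx_map f).
Proof.
by move=> [a b] [x1 y1] [x2 y2]; congr pair;
  rewrite /= !(linearD, linearN, linearZ).
Qed.

HB.instance Definition _ (f : 'End(L)) :=
  GRing.isLinear.Build R[i] LC LC _ (cplx_map f) (cplx_map_linear f).

Definition cplx_end (f : 'End(L)) : 'End(LC) := linfun (cplx_map f).

Lemma cplx_endE f z : cplx_end f z = (f z.1, f z.2).
Proof. by rewrite lfunE. Qed.

Definition cplx_sub (U : {vspace L}) : {vspace LC} :=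
  <<[seq cplx_of x | x <- vbasis U]>>%VS.

Lemma mem_cplx_sub U z : (z \in cplx_sub U) = (z.1 \in U) && (z.2 \in U).
Proof.
have cplxZ (a : R) x : a%:C *: cplx_of x = cplx_of (a *: x).
  by congr pair; rewrite /= ?scaler0 ?scale0r ?subr0 ?addr0.
have cplx_sum n (F : 'I_n -> L) : cplx_of (\sum_i F i) = \sum_i cplx_of (F i).
  elim/big_rec2: _ => // i u v _ <-.
  by congr pair; rewrite /= addr0.
have memU x : x \in U -> cplx_of x \in cplx_sub U.
  move=> /coord_vbasis ->; rewrite cplx_sum; apply: memv_suml => i _.
  rewrite -cplxZ memvZ // memv_span // map_f //.
  by rewrite mem_nth // size_tuple.
apply/idP/andP => [|[z1 z2]].
  move=> /(@coord_span _ _ _ (in_tuple _)) ->; apply/andP.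
  elim/big_ind: _ => [|u v /andP[u1 u2] /andP[v1 v2]|i _].
  - by rewrite !mem0v.
  - by rewrite !memvD.
  - case: (coord _ _ _) => a b.
    have /mapP[x /vbasis_mem xU ->] : (in_tuple [seq cplx_of x | x <- vbasis U])`_i
      \in [seq cplx_of x | x <- vbasis U] by rewrite mem_nth.
    by rewrite /= !scaler0 subr0 add0r !memvZ.
have -> : z = cplx_of z.1 + (0 +i* 1) *: cplx_of z.2.
  by case: z {z1 z2} => x y; congr pair;
    rewrite /= ?scaler0 ?scale0r ?scale1r ?subr0 ?addr0 ?add0r.
by rewrite memvD ?memvZ ?memU.
Qed.

End Complexification.

HB.mixin Record isTopGroup G of Group G & Topological G := {
  mulg_continuous : continuous (fun p : G * G => (p.1 * p.2)%g);
  invg_continuous : continuous (fun g : G => g^-1%g)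
}.

#[short(type="topGroupType")]
HB.structure Definition TopGroup :=
  {G of isTopGroup G & Group G & Topological G}.

Section GroupTheory.
Variable G : topGroupType.

Definition subgroup_set (H : set G) : Prop :=
  [/\ H 1%g, forall g h, H g -> H h -> H (g * h)%g
    & forall g, H g -> H g^-1%g].

Definition generated (X : set G) : set G := smallest subgroup_set X.

Definition group_center : set G := [set z | forall g, (z * g = g * z)%g].

Definition centralizer (H A : set G) : set G :=
  [set g | H g /\ forall a, A a -> (g * a = a * g)%g].

Definition normalizer (H A : set G) : set G :=
  [set g | H g /\ [set (g * a * g^-1)%g | a in A] = A].

End GroupTheory.

Arguments group_center G : clear implicits.

(* A Lie group with Lie algebra L, presented by its exponential map and its
   adjoint representation: ex is a local homeomorphism at 0 whose restrictions
   to lines are one-parameter subgroups, and the vector space structure and the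
   bracket of L are the ones induced by G (Trotter formula, Ad (exp x) =
   e^(ad x)).  Every real Lie group satisfies this; conversely a topological
   group with such a map is locally Euclidean, hence has a unique compatible
   Lie group structure, and L is its Lie algebra with exponential map ex.
   Topological statements about L are made in the coordinates v2r. *)
Record lie_group (R : realType) (L : lieAlgType R) (G : topGroupType)
    (ex : L -> G) (Ad : G -> 'End(L)) : Prop := {
  lie_group_hausdorff : hausdorff_space G;
  lie_group_exp_continuous : continuous (fun u : 'rV[R]_(dim L) => ex (r2v u));
  lie_group_exp_local_homeo : exists U : set 'rV[R]_(dim L),
    [/\ open U, U 0, {in U &, injective (fun u => ex (r2v u))}
      & forall V, open V -> V `<=` U -> open [set ex (r2v u) | u in V]];
  lie_group_expD : forall (s t : R) x,
    ex ((s + t) *: x) = (ex (s *: x) * ex (t *: x))%g;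
  lie_group_trotter : forall x y,
    (fun n : nat => ((ex (n%:R^-1 *: x) * ex (n%:R^-1 *: y)) ^+ n)%g) @ \oo
      --> ex (x + y);
  lie_group_AdJ : forall g x, (g * ex x * g^-1)%g = ex (Ad g x);
  lie_group_Ad_exp : forall x y,
    (fun n : nat => v2r (\sum_(k < n) (k`!%:R : R)^-1 *: iter k (lie x) y)) @ \oo
      --> v2r (Ad (ex x) y)
}.

Section CartanDecomposition.
Variables (R : realType) (L : lieAlgType R).

Definition cartan_involution (theta : 'End(L)) : Prop :=
  [/\ lie_endo theta, (forall x, theta (theta x) = x)
    & forall x, x != 0 -> 0 < - killing x (theta x)].

Definition k_space (theta : 'End(L)) : {vspace L} := passmx.leigenspace theta 1.
Definition p_space (theta : 'End(L)) : {vspace L} := passmx.leigenspace theta (-1).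

Definition m_space (theta : 'End(L)) (a : {vspace L}) : {vspace L} :=
  centralizer_in (k_space theta) a.

Definition orthonormal_basis (theta : 'End(L)) (a : {vspace L}) r
    (x : r.-tuple L) : Prop :=
  basis_of a x /\
  forall i j, - killing (cplx_of (tnth x i)) (cplx_of (theta (tnth x j)))
    = (i == j)%:R.

End CartanDecomposition.

Section RestrictedRoots.
Variables (R : realType) (L : lieAlgType R).
Variables (a t : {vspace L}).
Local Notation LC := (cplx L).

Definition cartan : {vspace LC} := cplx_sub (t + a).

Definition root_system : set (dual cartan) := roots cartan.

Definition restricted_roots : set (dual a) := roots a.

Definition roots_over (l : dual a) : set (dual cartan) :=
  [set al | root_system al /\
    forall x : subvs_of a, al (vsproj cartan (cplx_of (vsval x))) = (l x)%:C].

Definition mtp (l : dual a) : nat := #|` fset_set (roots_over l)|.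

Definition root_vectors (h e : dual cartan -> LC) : Prop :=
  forall al, root_system al ->
    [/\ h al \in cartan,
        (forall x : subvs_of cartan, killing (vsval x) (h al) = al x),
        weight_vector al (e al)
      & lie (e al) (e (- al)) = h al].

(* B(t_lambda, z) = lambda(z) for z = x + 'i y in the complexification of a *)
Definition coroot_vectors (tl : dual a -> LC) : Prop :=
  forall l, restricted_roots l -> tl l \in cplx_sub a /\
    forall x y : subvs_of a,
      killing (tl l) ((vsval x, vsval y) : LC) = l x +i* l y.

End RestrictedRoots.

Section RMatrices.
Variables (R : realType) (L : lieAlgType R) (G : topGroupType).
Variables (ex : L -> G) (Ad : G -> 'End(L)) (theta : 'End(L)).
Variables (a t : {vspace L}).
Local Notation LC := (cplx L).
Local Notation C := R[i].

(* the connected Lie subgroup with Lie algebra k is generated by exp(k) *)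
Definition K_group : set G := generated [set ex x | x in [set` k_space theta]].
Definition A_group : set G := [set ex x | x in [set` a]].
Definition M_group : set G := centralizer K_group A_group.

(* the representatives of the elements of W = N_K(A) / M *)
Definition NKA_group : set G := normalizer K_group A_group.

Definition log_A (g : G) : L := xget 0 [set x | x \in a /\ ex x = g].

Definition xi (l : dual a) (g : G) : C := (expR (l (vsproj a (log_A g))))%:C.

Definition A_reg : set G :=
  [set g | A_group g /\ forall l, restricted_roots l -> xi l g != 1].

Definition unital_subalgebra (T : Type) (S : set (T -> C)) : Prop :=
  [/\ S (fun=> 1),
      forall (c : C) f g, S f -> S g -> S (fun x => c * f x + g x)
    & forall f g, S f -> S g -> S (fun x => f x * g x)].

(* Generating inside all functions on A_reg gives the same subalgebra as
   generating inside the smooth ones. *)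
Definition R_algebra : set (A_reg -> C) :=
  smallest (@unital_subalgebra A_reg)
    [set f | exists2 l, restricted_roots l &
       f = (fun g => (1 + xi l (val g))^-1) \/
       f = (fun g => (1 - xi l (val g))^-1)].

Definition Ad_tensor (g : G) : tensor LC -> tensor LC :=
  tens_map (cplx_end (Ad g)) (cplx_end (Ad g)).

Definition M_invariant (T : tensor LC) : Prop :=
  forall m, M_group m -> Ad_tensor m T = T.

(* The tensor product of R with the M-invariants of g (x) g, embedded into the
   functions from A_reg to g (x) g. *)
Definition in_R_tensor_M (F : A_reg -> tensor LC) : Prop :=
  exists n (f : 'I_n -> A_reg -> C) (T : 'I_n -> tensor LC),
    [/\ forall i, R_algebra (f i), forall i, M_invariant (T i)
      & forall g, F g = \sum_i f i g *: T i].

(* w xi_lambda = xi_(w lambda) is xi_lambda composed with w^-1, so w maps F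
   to the function w g w^-1 |-> Ad(w) (F g). *)
Definition W_invariant (F : A_reg -> tensor LC) : Prop :=
  forall w, NKA_group w -> forall g g' : A_reg,
    val g' = (w * val g * w^-1)%g -> F g' = Ad_tensor w (F g).

Variables (h e : dual (cartan a t) -> LC) (tl : dual a -> LC).
Variables (r d n : nat) (x : r.-tuple L) (c c' : d.-tuple LC).
Variables (b b' : n.-tuple LC).
Variables (U : algType C) (iU : {linear LC -> U}).

Local Notation thetaC := (cplx_end theta).

Definition pr_k : 'End(LC) := 2^-1 *: (\1 + thetaC)%VF.
Definition pr_p : 'End(LC) := 2^-1 *: (\1 - thetaC)%VF.

Definition varpi (l : dual a) : tensor LC :=
  \sum_(al \in @roots_over R L a t l) tens (e (- al)) (e al).

Definition varpi_m : tensor LC := \sum_s tens (tnth c s) (tnth c' s).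

Definition sum_xx : tensor LC :=
  \sum_j tens (cplx_of (tnth x j)) (cplx_of (tnth x j)).

Definition casimir : U := \sum_s iU (tnth b s) * iU (tnth b' s).

Definition r_plus (g : G) : tensor LC :=
  - varpi_m - \sum_(l \in @restricted_roots R L a)
    (2 / (1 - xi (- (l *+ 2)) g)) *: tens_map pr_k \1%VF (varpi l).

Definition r_minus (g : G) : tensor LC :=
  sum_xx + \sum_(l \in @restricted_roots R L a)
    (2 / (1 - xi (- (l *+ 2)) g)) *: tens_map pr_p \1%VF (varpi l).

Definition r_mx (g : G) : tensor LC :=
  - (2^-1 *: varpi_m) - 2^-1 *: sum_xx - \sum_(l \in @restricted_roots R L a)
    (1 - xi (- (l *+ 2)) g)^-1 *: varpi l.

Definition kappa_core (g : G) : U :=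
  2^-1 *: casimir + mult_map iU (tens_swap (r_plus g)).

End RMatrices.

(* Main.v *)
(* A tensor T on g (x) g is determined by the endomorphism
   z |-> sum B(z, T'') T' of g, because the Killing form B is nondegenerate.
   Under this correspondence varpi_m and varpi_lambda become the projections of
   g = m + a + sum_lambda g_lambda onto m and g_(-lambda), so that every
   identity between them (exchange of the components, theta (x) theta,
   Ad(w) (x) Ad(w)) only needs to be checked on m, a and the g_lambda.

   That g is spanned by m, a and the given root vectors uses the Hermitian form
   -B(z, tau w), tau being the conjugation with respect to the compact form:
   tau maps g_alpha to g_(-alpha), and if y in g_alpha is orthogonal to e_alpha,
   then [tau e_alpha, y] = 0, hence |[e_alpha, y]|^2 is a negative multiple of
   |y|^2 and y = 0.

   For the group, Ad(g) is an automorphism of the Lie algebra because the power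
   series of Ad(g) e^(s ad x) and e^(s ad Ad(g) x) Ad(g) agree, and the
   representatives of W normalize a since Ad(w) a is contained in p and commutes
   with a. *)
From HB Require Import structures.
Require Import Defs.
From mathcomp Require Import all_boot all_order all_algebra.
From mathcomp Require Import finmap complex ring lra spectral.
From mathcomp Require Import all_classical all_reals all_analysis.

Set Implicit Arguments.
Unset Strict Implicit.
Unset Printing Implicit Defensive.

Import Order.TTheory GRing.Theory Num.Theory.
Import numFieldNormedType.Exports.
Import VectorInternalTheory.

Local Open Scope classical_set_scope.
Local Open Scope complex_scope.
Local Open Scope ring_scope.

(** * Endomorphisms and the Killing form *)

(** The root vectors are prescribed only by their weights and by [e_alpha, e_(-alpha)] = h_alpha, so
    theta and Ad(w) carry them to other root vectors with uncontrolled scalars. Only the sums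
    varpi_lambda are canonical, hence the comparison of operators instead of summands.

    The formulas for r^+ and r^- come from 2 pr_k = id + theta and 2 pr_p = id - theta, once (id (x)
    theta) r_21 = (theta (x) id) r is known.

    In kappa, the m- and a-parts of Omega/2 cancel those of mu(r_21), and mu(varpi_lambda) keeps the
    coefficient 1/2 - 1/(1 - xi_(2 lambda)), which is odd in lambda. Pairing lambda with -lambda
    therefore replaces the products by commutators, that is, by the h_alpha; a factor 1/2 from the
    coefficient and another from the pairing give 1/4. The h_alpha over lambda add up to mtp(lambda)
    t_lambda because the t-component of their sum vanishes. *)

Section Endomorphisms.
Variables (K : fieldType) (L : vectType K).
Implicit Types (f g : 'End(L)).

Lemma v2r_hom (M : vectType K) (f : 'Hom(L, M)) x : v2r (f x) = v2r x *m f2mx f.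
Proof. by rewrite unlock /fun_of_lfun_def /= r2vK. Qed.

Fact f2mx_linear : linear (f2mx : 'End(L) -> _).
Proof.
move=> k f g; apply/row_matrixP => i; rewrite !rowE -[delta_mx 0 i]r2vK.
rewrite -v2r_hom mulmxDr -scalemxAr -!v2r_hom.
by rewrite add_lfunE scale_lfunE linearP.
Qed.

HB.instance Definition _ := GRing.isLinear.Build K 'End(L) 'M[K]_(dim L, dim L) _ f2mx f2mx_linear.

Lemma f2mx_comp f g : f2mx (f \o g)%VF = f2mx g *m f2mx f.
Proof.
apply/row_matrixP => i; rewrite !rowE mulmxA -[delta_mx 0 i]r2vK.
by rewrite -!v2r_hom comp_lfunE.
Qed.

Lemma f2mx_trace f : \tr (f2mx f) = \sum_i v2r (f (r2v (delta_mx 0 i))) 0 i.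
Proof.
by apply: eq_bigr => i _; rewrite v2r_hom r2vK -rowE mxE.
Qed.

Lemma vec_coord (x : L) : x = \sum_i v2r x 0 i *: r2v (delta_mx 0 i).
Proof.
rewrite -[LHS]v2rK {1}[v2r x]row_sum_delta linear_sum.
by apply: eq_bigr => i _; rewrite linearZ.
Qed.

End Endomorphisms.

(** Commuting matrices over an algebraically closed field share an eigenvector; restricting them to
    a row base of [V] places this eigenvector inside the invariant subspace. *)
Lemma common_eigenvector_in (C : numClosedFieldType) (L : vectType C)
    (s : seq 'End(L)) (V : {vspace L}) :
  V != 0%VS -> (forall f v, f \in s -> v \in V -> f v \in V) ->
  (forall f g v, f \in s -> g \in s -> f (g v) = g (f v)) ->
  exists v, [/\ v \in V, v != 0
    & forall f, f \in s -> exists k : C, f v = k *: v].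
Proof.
move=> V0 sV sC.
have memV (u : 'rV[C]_(dim L)) : (u <= vs2mx V)%MS = (r2v u \in V).
  by rewrite memvE /subsetv mx2vsK r2vK.
have stab f : f \in s -> stablemx (vs2mx V) (f2mx f).
  move=> fs; apply/row_subP => i; rewrite row_mul memV.
  rewrite -[row i _]r2vK -v2r_hom v2rK; apply: sV => //.
  by rewrite -memV row_sub.
have cmm f g : f \in s -> g \in s -> comm_mx (f2mx f) (f2mx g).
  move=> fs gs; rewrite /comm_mx -!f2mx_comp; congr f2mx.
  by apply/lfunP => v; rewrite !comp_lfunE sC.
have rk : (0 < \rank (vs2mx V))%N.
  rewrite lt0n; apply: contra V0 => /eqP rk0.
  by rewrite -dimv_eq0 /dimv rk0.
have [|v v0 /allP vP] := @common_eigenvector _ _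
    [seq restrictmx (vs2mx V) (f2mx f) | f <- s] rk.
  move=> _ _ /mapP[f fs ->] /mapP[g gs ->].
  rewrite /comm_mx -!conjmxM ?inE ?stablemx_row_base ?stab //.
  by rewrite (cmm f g fs gs).
pose u := v *m row_base (vs2mx V).
have u0 : u != 0 by rewrite mulmx_free_eq0 ?row_base_free.
exists (r2v u); split.
- by rewrite -memV (submx_trans (submxMl _ _)) // eq_row_base.
- by apply: contra u0 => /eqP/(congr1 v2r); rewrite r2vK linear0 => ->.
- move=> f fs.
  have /vP : restrictmx (vs2mx V) (f2mx f) \in
    [seq restrictmx (vs2mx V) (f2mx f) | f <- s] by apply: map_f.
  rewrite stablemx_restrict ?stab // -/u => /sub_rVP[k fu].
  by exists k; apply: v2r_inj; rewrite v2r_hom r2vK linearZ /= r2vK.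
Qed.

Section Killing.
Variables (K : fieldType) (L : lieAlgType K).
Implicit Types (x y z : L) (f : 'End(L)).

Local Notation B := (@killing K L).

Lemma adD x y : ad (x + y) = ad x + ad y.
Proof. by apply/lfunP => z; rewrite add_lfunE !adE lieDl. Qed.

Lemma adZ k x : ad (k *: x) = k *: ad x.
Proof. by apply/lfunP => z; rewrite scale_lfunE !adE lieZl. Qed.

Lemma ad_lie x y : ad (lie x y) = (ad x \o ad y)%VF - (ad y \o ad x)%VF.
Proof.
apply/lfunP => z; rewrite !lfunE /= opp_lfunE !comp_lfunE !adE.
have /eqP := lie_jacobi x y z; rewrite addr_eq0 => /eqP J.
by rewrite lieC -J [lie z x]lieC lieNr.
Qed.

Lemma killingE x y : B x y = \tr (f2mx (ad y) *m f2mx (ad x)).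
Proof. by rewrite /killing f2mx_comp. Qed.

Lemma killingC x y : B x y = B y x.
Proof. by rewrite !killingE mxtrace_mulC. Qed.

Lemma killing_linear x : linear (B x : L -> K^o).
Proof.
move=> k y z; rewrite !killingE adD adZ linearP mulmxDl -scalemxAl.
by rewrite linearD linearZ.
Qed.

HB.instance Definition _ x :=
  GRing.isLinear.Build K L K^o _ (killing x) (killing_linear x).

Lemma killingDr x y z : B x (y + z) = B x y + B x z.
Proof. exact: linearD. Qed.
Lemma killingZr k x y : B x (k *: y) = k * B x y.
Proof. exact: linearZ. Qed.
Lemma killingNr x y : B x (- y) = - B x y.
Proof. exact: linearN. Qed.
Lemma killing0r x : B x 0 = 0.
Proof. exact: linear0. Qed.
Lemma killing_sumr I (s : seq I) (P : pred I) (F : I -> L) x :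
  B x (\sum_(i <- s | P i) F i) = \sum_(i <- s | P i) B x (F i).
Proof. exact: linear_sum. Qed.
Lemma killingDl x y z : B (y + z) x = B y x + B z x.
Proof. by rewrite killingC killingDr ![B x _]killingC. Qed.
Lemma killingZl k x y : B (k *: y) x = k * B y x.
Proof. by rewrite killingC killingZr [B x _]killingC. Qed.
Lemma killingNl x y : B (- y) x = - B y x.
Proof. by rewrite killingC killingNr [B x _]killingC. Qed.
Lemma killing0l x : B 0 x = 0.
Proof. by rewrite killingC killing0r. Qed.
Lemma killing_suml I (s : seq I) (P : pred I) (F : I -> L) x :
  B (\sum_(i <- s | P i) F i) x = \sum_(i <- s | P i) B (F i) x.
Proof. by rewrite killingC killing_sumr; apply: eq_bigr => i _; rewrite killingC. Qed.

Definition killing_bilinear := (killingDr, killingDl, killingZr, killingZl, killingNr, killingNl).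

Lemma killing_lie x y z : B (lie x y) z = B x (lie y z).
Proof.
rewrite !killingE !ad_lie !linearB /= !f2mx_comp mulmxBl linearB /=.
by rewrite !mulmxA [X in _ - X]mxtrace_mulC mulmxA.
Qed.

End Killing.

Section KillingAut.
Variables (K : fieldType) (L : lieAlgType K) (f g : 'End(L)).
Hypotheses (fL : lie_endo f) (fK : cancel f g) (gK : cancel g f).

(** [ad (f z)] is the conjugate of [ad z] by [f], and the trace does not see conjugation. *)
Lemma killing_aut x y : killing (f x) (f y) = killing x y.
Proof.
have E z : ad (f z) = (f \o ad z \o g)%VF.
  by apply/lfunP => w; rewrite !comp_lfunE !adE fL gK.
have fg : f2mx f *m f2mx g = 1%:M.
  rewrite -f2mx_comp; apply/row_matrixP => i; rewrite !rowE -[delta_mx 0 i]r2vK.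
  by rewrite -v2r_hom comp_lfunE fK mulmx1.
rewrite !killingE !E !f2mx_comp !mulmxA mxtrace_mulC !mulmxA fg mul1mx.
by rewrite -[_ *m f2mx f *m f2mx g]mulmxA fg mulmx1.
Qed.

End KillingAut.

Section CplxKilling.
Variables (R : rcfType) (L : lieAlgType R).
Local Notation LC := (cplx L).
Local Notation C := R[i].

Lemma cplxE (z : LC) : z = cplx_of z.1 + 'i *: cplx_of z.2.
Proof.
by case: z => x y; congr pair;
  rewrite /= ?scaler0 ?scale0r ?scale1r ?subr0 ?addr0 ?add0r.
Qed.

Lemma cplxZE (c : C) (z : LC) :
  c *: z = (complex.Re c *: z.1 - complex.Im c *: z.2, complex.Re c *: z.2 + complex.Im c *: z.1).
Proof. by case: c. Qed.

Lemma cplx_ofD (x y : L) : cplx_of (x + y) = cplx_of x + cplx_of y.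
Proof. by congr pair; rewrite /= addr0. Qed.

Lemma cplx_ofZ (k : R) (x : L) : cplx_of (k *: x) = k%:C *: cplx_of x.
Proof. by congr pair; rewrite /= ?scaler0 ?scale0r ?subr0 ?addr0. Qed.

Lemma cplx_of_lie (x y : L) : cplx_of (lie x y) = lie (cplx_of x) (cplx_of y).
Proof.
have l0 (z : L) : lie 0 z = 0 by rewrite -(scale0r 0) lieZl !scale0r.
have r0 : lie x 0 = 0 by rewrite lieC l0 oppr0.
by rewrite [RHS]/(lie _ _) /= /cplx_lie /= !l0 r0 subr0 addr0.
Qed.

Lemma killing_cplx_of (x y : L) :
  killing (cplx_of x) (cplx_of y) = (killing x y)%:C.
Proof.
rewrite /killing !f2mx_trace.
pose c i (z : LC) : C := v2r z.1 0 i +i* v2r z.2 0 i.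
have cP i (k : C) z w : c i (k *: z + w) = k * c i z + c i w.
  have := cplx_v2r_linear k z w => /rowP/(_ i).
  by rewrite !mxE.
have cS i (J : finType) (F : J -> C) (G : J -> LC) :
    c i (\sum_j F j *: G j) = \sum_j F j * c i (G j).
  have c0 : c i 0 = 0.
    by rewrite /c /= !linear0 !mxE.
  elim/big_rec2: _ => // j u v _ <-; exact: cP.
have zE (z : LC) : z = \sum_i c i z *: cplx_of (r2v (delta_mx 0 i)).
  rewrite [LHS]cplxE {1}[z.1]vec_coord {1}[z.2]vec_coord.
  have so : {morph (@cplx_of R L) : x y / x + y} by exact: cplx_ofD.
  have so0 : cplx_of (0 : L) = 0 by [].
  rewrite !(big_morph _ so so0) scaler_sumr -big_split /=.
  apply: eq_bigr => i _; rewrite !cplx_ofZ scalerA -scalerDl; congr (_ *: _).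
  by rewrite /c /= [RHS]complexE.
(* Base change for the trace: the abstract basis of the complexification is expanded in the real
   coordinate vectors, and exchanging the two sums yields the trace in the latter. *)
under eq_bigr => i _ do rewrite [r2v _]zE linear_sum linear_sum summxE /=.
under eq_bigr => i _ do under eq_bigr => j _ do rewrite linearZ linearZ mxE.
rewrite exchange_big /= raddf_sum; apply: eq_bigr => j _.
transitivity (c j ((ad (cplx_of x) \o ad (cplx_of y))%VF (cplx_of (r2v (delta_mx 0 j))))).
  rewrite [X in c j X]vec_coord cS.
  by apply: eq_bigr => i _; rewrite mulrC.
by rewrite /c !comp_lfunE !adE -!cplx_of_lie /= linear0 mxE.
Qed.

Lemma killing_cplxE (z w : LC) : killing z w =
  (killing z.1 w.1 - killing z.2 w.2) +i* (killing z.1 w.2 + killing z.2 w.1).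
Proof.
rewrite {1}[z]cplxE {1}[w]cplxE !killing_bilinear !killing_cplx_of; simpc.
by rewrite [X in _ +i* X]addrC.
Qed.

Lemma cplx_end_lie (f : 'End(L)) : lie_endo f -> lie_endo (cplx_end f).
Proof.
move=> fL z w; rewrite !cplx_endE /=; congr pair => /=.
  by rewrite linearB /= !fL.
by rewrite linearD /= !fL.
Qed.

End CplxKilling.

(** * Tensors as endomorphisms *)

Section TensorOp.
Variables (K : fieldType) (L : lieAlgType K).
Implicit Types (T : tensor L) (x y z : L).

Definition killing_mx : 'M[K]_(dim L) :=
  \matrix_(i, j) killing (coord_vec i) (coord_vec j).

Lemma killing_v2r x y : killing x y = (v2r x *m killing_mx *m (v2r y)^T) 0 0.
Proof.
rewrite {1}[x]vec_coord {1}[y]vec_coord killing_suml -mulmxA mxE.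
apply: eq_bigr => i _; rewrite killingZl; congr (_ * _).
rewrite killing_sumr mxE; apply: eq_bigr => j _.
by rewrite killingZr !mxE mulrC.
Qed.

Definition tens_op T x : L := r2v (v2r x *m killing_mx *m T^T).

Fact tens_op_linear T : linear (tens_op T).
Proof.
by move=> k x y; rewrite /tens_op linearP !mulmxDl -!scalemxAl linearP.
Qed.

HB.instance Definition _ T :=
  GRing.isLinear.Build K L L _ (tens_op T) (tens_op_linear T).

Lemma tens_op_tens x y z : tens_op (tens y z) x = killing x z *: y.
Proof.
apply: v2r_inj; rewrite r2vK linearZ /tens trmx_mul trmxK mulmxA killing_v2r /=.
by rewrite {1}[_ *m _^T]mx11_scalar mul_scalar_mx.
Qed.

Lemma tens_opD T T' x : tens_op (T + T') x = tens_op T x + tens_op T' x.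
Proof. by rewrite /tens_op linearD mulmxDr linearD. Qed.

Lemma tens_op_sum I (s : seq I) (P : pred I) (F : I -> tensor L) x :
  tens_op (\sum_(i <- s | P i) F i) x = \sum_(i <- s | P i) tens_op (F i) x.
Proof. by rewrite /tens_op raddf_sum mulmx_sumr raddf_sum. Qed.

(** The first component is the output of the operator, while the second is paired with the argument;
    hence [g] enters through its Killing adjoint. *)
Lemma tens_op_map (f g g' : 'End(L)) T x :
  (forall y z, killing (g y) z = killing y (g' z)) ->
  tens_op (tens_map f g T) x = f (tens_op T (g' x)).
Proof.
move=> gg'; apply: v2r_inj; rewrite v2r_hom !r2vK /tens_map !trmx_mul trmxK.
rewrite !mulmxA; do 2!congr (_ *m _); apply/rowP => k.
have E (u : 'rV[K]_(dim L)) : u 0 k = (u *m (v2r (coord_vec k))^T) 0 0.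
  by rewrite r2vK trmx_delta -colE mxE.
rewrite !E -killing_v2r [RHS]killingC -gg' killingC killing_v2r.
by rewrite v2r_hom trmx_mul mulmxA.
Qed.

Hypothesis nondeg : forall x, (forall y, killing x y = 0) -> x = 0.

Lemma killing_mx_unit : killing_mx \in unitmx.
Proof.
rewrite -row_free_unit -kermx_eq0; apply/rowV0P => u /sub_kermxP uK.
apply: r2v_inj; rewrite linear0; apply: nondeg => y.
by rewrite killing_v2r r2vK uK mul0mx mxE.
Qed.

Lemma tens_op_inj T T' : tens_op T =1 tens_op T' -> T = T'.
Proof.
move=> E; apply: trmx_inj; apply: (can_inj (mulKmx killing_mx_unit)).
apply/row_matrixP => i; rewrite !rowE !mulmxA.
by have /(congr1 v2r) := E (coord_vec i); rewrite /tens_op !r2vK.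
Qed.

End TensorOp.

(** * The compact conjugation *)

Section CartanInvolution.
Variables (R : realType) (L : lieAlgType R) (theta : 'End(L)).
Hypothesis htheta : cartan_involution theta.
Local Notation LC := (cplx L).
Local Notation C := R[i].
Implicit Types (z w : LC).

Let thetaL : lie_endo theta. Proof. by case: htheta. Qed.
Let thetaK : involutive theta. Proof. by case: htheta. Qed.

Let thetaN x : theta (- x) = - theta x. Proof. exact: linearN. Qed.

Lemma killing_theta x y : killing (theta x) y = killing x (theta y).
Proof. by rewrite -{1}[y]thetaK (killing_aut thetaL thetaK thetaK). Qed.

Lemma cplx_thetaK : involutive (cplx_end theta).
Proof. by case=> x y; rewrite !cplx_endE /= !thetaK. Qed.

Lemma killing_cplx_theta z w :
  killing (cplx_end theta z) w = killing z (cplx_end theta w).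
Proof.
rewrite -{1}[w]cplx_thetaK.
exact: (killing_aut (cplx_end_lie thetaL) cplx_thetaK cplx_thetaK).
Qed.

(* the conjugation of the complexification with respect to the compact real
   form k + i p *)
Definition cpt_conj z : LC := (theta z.1, - theta z.2).
Local Notation tau := cpt_conj.

Lemma cpt_conjK : involutive tau.
Proof. by case=> x y; congr pair; rewrite /= ?thetaN ?opprK thetaK. Qed.

Lemma cpt_conjZ (c : C) z : tau (c *: z) = conjc c *: tau z.
Proof.
case: c z => [p q] [x y]; rewrite /tau /=; congr pair => /=.
  by rewrite linearB !linearZ /= scalerN scaleNr opprK.
by rewrite linearD !linearZ /= scalerN scaleNr opprD.
Qed.

Lemma cpt_conj_lie z w : tau (lie z w) = lie (tau z) (tau w).
Proof.
case: z w => [x y] [x' y']; rewrite /tau /=; congr pair => /=.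
  by rewrite linearB /= !thetaL lieNl lieNr opprK.
by rewrite linearD /= !thetaL lieNl lieNr opprD.
Qed.

Lemma killing_cpt_conj z w : killing (tau z) (tau w) = conjc (killing z w).
Proof.
rewrite !killing_cplxE /tau /= !(killingNl, killingNr) opprK.
by rewrite !killing_theta !thetaK opprD.
Qed.

(** The mixed terms of real and imaginary part cancel by symmetry, and two values of the positive
    definite real form -B(x, theta x) remain. *)
Lemma cpt_herm_gt0 z : z != 0 -> 0 < - killing z (tau z).
Proof.
move=> z0; case: htheta => _ _ pos.
have pos0 x : 0 <= - killing x (theta x).
  by have [->|/pos/ltW//] := eqVneq x 0; rewrite killing0l oppr0.
have -> : - killing z (tau z) =
    (- killing z.1 (theta z.1) - killing z.2 (theta z.2))%:C.
  rewrite killing_cplxE /tau /= !killingNr [killing z.2 (theta z.1)]killingC.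
  by rewrite killing_theta addNr opprK -[LHS]/(_ +i* _) oppr0 opprD.
rewrite ltcR; have [x0|x0] := eqVneq z.1 0.
  have y0 : z.2 != 0.
    by apply: contra z0 => /eqP y0; case: z x0 y0 => x y /= -> ->.
  by rewrite ltr_wpDl // pos.
by rewrite ltr_pwDl // pos.
Qed.

Lemma cpt_herm_eq0 z : killing z (tau z) = 0 -> z = 0.
Proof.
move=> z0; apply/eqP; apply: contraT => /cpt_herm_gt0.
by rewrite z0 oppr0 ltxx.
Qed.

Lemma cplx_killing_nondeg z : (forall w, killing z w = 0) -> z = 0.
Proof. by move=> z0; apply: cpt_herm_eq0. Qed.

Lemma killing_nondeg (x : L) : (forall y, killing x y = 0) -> x = 0.
Proof.
case: htheta => _ _ pos x0; apply/eqP; apply: contraT => /pos.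
by rewrite x0 oppr0 ltxx.
Qed.

Lemma mem_k_space x : (x \in k_space theta) = (theta x == x).
Proof.
by rewrite memv_ker !lfun_simp scale1r subr_eq0.
Qed.

Lemma mem_p_space x : (x \in p_space theta) = (theta x == - x).
Proof.
by rewrite memv_ker !lfun_simp scaleN1r opprK addr_eq0.
Qed.

Section Subspaces.
Variables (a t : {vspace L}).
Hypothesis ha : maximal_abelian_in a (p_space theta).
Hypothesis ht : maximal_abelian_in t (m_space theta a).
Local Notation m := (m_space theta a).

Lemma mem_m_space x : reflect (theta x = x /\ forall y, y \in a -> lie y x = 0) (x \in m).
Proof.
by apply: (iffP (centralizer_inP _ _ _)) => -[]; rewrite mem_k_space => /eqP.
Qed.

Lemma theta_a x : x \in a -> theta x = - x.
Proof. by case: ha => /subvP ap _ _ /ap; rewrite mem_p_space => /eqP. Qed.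

Lemma abelian_a : abelian_sub a.
Proof. by case: ha. Qed.

(** Adjoining to [U] a vector that commutes with it keeps it abelian, so maximality absorbs the
    vector. *)
Lemma maximal_abelianP (U V : {vspace L}) x : maximal_abelian_in U V ->
  x \in V -> (forall y, y \in U -> lie y x = 0) -> x \in U.
Proof.
case=> UV abU maxU xV xU.
have <- : (U + <[x]>)%VS = U.
  apply: maxU; rewrite ?addvSl // ?subv_add ?UV -?memvE //.
  move=> y z /memv_addP[u uU [_ /vlineP[k ->] ->]].
  move=> /memv_addP[v vU [_ /vlineP[l ->] ->]].
  rewrite lieDl !lieDr !lieZl !lieZr lie_alt abU // xU // !scaler0 !addr0 add0r.
  by rewrite lieC xU // oppr0 scaler0.
by rewrite memvE addvSr.
Qed.

(** Since theta is -1 on a, the centralizer of a is stable under theta. The k-part of [x] is in m by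
    definition, the p-part in a by maximality. *)
Lemma centralizer_a x : (forall y, y \in a -> lie y x = 0) ->
  exists u v, [/\ u \in m, v \in a & x = u + v].
Proof.
move=> xa.
have xa' y : y \in a -> lie y (theta x) = 0.
  by move=> ya; rewrite -[y]thetaK -thetaL (theta_a ya) lieNl xa // oppr0 linear0.
pose u := 2^-1 *: (x + theta x); pose v := 2^-1 *: (x - theta x).
have n2 : (2 : R) != 0 by rewrite pnatr_eq0.
exists u, v; split.
- apply/mem_m_space; split; first by rewrite linearZ linearD /= thetaK addrC.
  by move=> y ya; rewrite lieZr lieDr xa // xa' // addr0 scaler0.
- apply: (maximal_abelianP ha).
    by rewrite mem_p_space linearZ linearB /= thetaK -scalerN opprB.
  by move=> y ya; rewrite lieZr lieDr lieNr xa // xa' // subrr scaler0.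
- by rewrite -scalerDr addrACA subrr addr0 -mulr2n -(scaler_nat 2 x) scalerA mulVf // scale1r.
Qed.

End Subspaces.
End CartanInvolution.

(** * Roots and restricted roots *)

(** The functionals make every finite subfamily of the vectors free, so it has at most [dim V]
    members. This yields the finiteness of both root systems. *)
Lemma finite_dual_family (K : fieldType) (V : vectType K) (T : choiceType)
    (S : set T) (v : T -> V) (b : T -> {linear V -> K^o}) :
  (forall s, S s -> b s (v s) != 0) ->
  (forall s s', S s -> S s' -> s != s' -> b s (v s') = 0) -> finite_set S.
Proof.
move=> b1 b0; apply: contrapT.
move=> /(infinite_set_fset (dim V).+1)[B BS].
pose s := in_tuple (enum_fset B).
have sS i : S (tnth s i) by apply: BS; exact: mem_tnth.
have us i j : (tnth s i == tnth s j) = (i == j).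
  have [x0 _] : exists x0 : T, True by exists (tnth s i).
  by rewrite !(tnth_nth x0) nth_uniq ?fset_uniq ?size_tuple.
suff : free (map_tuple v s).
  rewrite /free size_tuple => /eqP <-; rewrite ltnNge -dimvf => /negP; apply.
  by rewrite dimvS ?subvf.
apply/freeP => c c0 i.
have nE (j : 'I_#|` B|) : (map_tuple v s)`_j = v (tnth s j) by rewrite -tnth_nth tnth_map.
have := congr1 (b (tnth s i)) c0; rewrite linear0 linear_sum.
under eq_bigr => j _ do rewrite nE linearZ /=.
rewrite (bigD1 i) //= big1 => [|j ji]; last first.
  by rewrite b0 ?scaler0 // us eq_sym.
rewrite addr0 => /eqP; rewrite mulf_eq0.
by rewrite (negPf (b1 _ (sS i))) orbF => /eqP.
Qed.

Lemma lie0l (K : fieldType) (L : lieAlgType K) (x : L) : lie 0 x = 0.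
Proof. by rewrite -(scale0r 0) lieZl !scale0r. Qed.

Lemma lie0r (K : fieldType) (L : lieAlgType K) (x : L) : lie x 0 = 0.
Proof. by rewrite lieC lie0l oppr0. Qed.

Lemma lie_derivation (K : fieldType) (L : lieAlgType K) (k u v : L) :
  lie k (lie u v) = lie (lie k u) v + lie u (lie k v).
Proof.
have /eqP := lie_jacobi k u v; rewrite -addrA addr_eq0 => /eqP ->.
by rewrite opprD addrC [in RHS]lieC [lie v k]lieC lieNr opprK.
Qed.

Section Roots.
Variables (R : realType) (L : lieAlgType R) (theta : 'End(L)).
Hypothesis htheta : cartan_involution theta.
Variables (a t : {vspace L}).
Hypothesis ha : maximal_abelian_in a (p_space theta).
Hypothesis ht : maximal_abelian_in t (m_space theta a).
Local Notation LC := (cplx L).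
Local Notation C := R[i].
Local Notation tau := (cpt_conj theta).
Local Notation H := (cartan a t).
Implicit Types (z w k : LC) (al be : dual H).

Lemma t_sub_m x : x \in t -> theta x = x /\ forall y, y \in a -> lie y x = 0.
Proof. by case: ht => /subvP tm _ _ /tm /mem_m_space. Qed.

Lemma cartan_real_abelian x y : x \in (t + a)%VS -> y \in (t + a)%VS -> lie x y = 0.
Proof.
move=> /memv_addP[u ut [v va ->]] /memv_addP[u' ut' [v' va' ->]].
rewrite lieDl !lieDr; case: (t_sub_m ut) (t_sub_m ut') => _ uc [_ uc'].
case: ht => _ tab _; rewrite tab // uc' // [lie u v']lieC uc // (abelian_a ha) // oppr0.
by rewrite !addr0.
Qed.

Lemma theta_cartan x : x \in (t + a)%VS -> theta x \in (t + a)%VS.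
Proof.
move=> /memv_addP[u ut [v va ->]]; rewrite linearD /=.
case: (t_sub_m ut) => -> _; rewrite (theta_a ha va).
by apply: memv_add; rewrite ?memvN.
Qed.

Lemma cartan_abelian z w : z \in H -> w \in H -> lie z w = 0.
Proof.
rewrite !mem_cplx_sub => /andP[z1 z2] /andP[w1 w2].
by congr pair => /=; rewrite !cartan_real_abelian ?subr0 ?addr0.
Qed.

Lemma cpt_conj_cartan z : z \in H -> tau z \in H.
Proof.
by rewrite !mem_cplx_sub => /andP[z1 z2]; rewrite memvN !theta_cartan.
Qed.

Lemma mem_cplx_of (U : {vspace L}) x : (cplx_of x \in cplx_sub U) = (x \in U).
Proof. by rewrite mem_cplx_sub mem0v andbT. Qed.

Lemma lie_cplx_of x z : lie (cplx_of x) z = (lie x z.1, lie x z.2).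
Proof.
by rewrite [LHS]/(lie _ _) /= /cplx_lie /= !lie0l subr0 addr0.
Qed.

(** On real and imaginary parts: commuting with a leaves m + a, and the m-component also commutes
    with t, so maximality of t applies to it. *)
Lemma cartan_self_centralizing z : (forall k, k \in H -> lie k z = 0) -> z \in H.
Proof.
move=> zH; rewrite mem_cplx_sub.
suff F x : (forall y, y \in (t + a)%VS -> lie y x = 0) -> x \in (t + a)%VS.
  by apply/andP; split; apply: F => y yta; have := zH (cplx_of y);
    rewrite mem_cplx_of lie_cplx_of => /(_ yta) [].
move=> xc; have [y ya|u [v [um va xE]]] := centralizer_a htheta ha (x := x).
  by rewrite xc // (subvP (addvSr _ _)).
rewrite xE memv_add //; apply: (maximal_abelianP ht um) => y yt.
have := xc y; rewrite (subvP (addvSl _ _)) // xE lieDr [lie y v]lieC.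
by case: (t_sub_m yt) => _ -> // /(_ isT); rewrite oppr0 addr0.
Qed.

(** Unlike [weight_vector] this admits zero, so that it is closed under linear combinations. *)
Definition root_vec al z := forall k, k \in H -> lie k z = (al (vsproj H k) : C) *: z.

Lemma weight_root_vec al z : weight_vector al z -> root_vec al z.
Proof. by move=> [_ zw] k kH; rewrite -zw vsprojK. Qed.

Lemma root_vec_weight al z : z != 0 -> root_vec al z -> weight_vector al z.
Proof. by move=> z0 zw; split=> // k; rewrite zw ?subvsP // vsvalK. Qed.

Lemma dual_neq0 (K : fieldType) (V : lieAlgType K) (U : {vspace V}) (l : dual U) :
  l != 0 -> exists2 k, k \in U & (l (vsproj U k) : K) != 0.
Proof.
move=> l0; apply: contrapT => nk; move/eqP: l0; apply; apply/lfunP => k.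
rewrite zero_lfunE; apply/eqP; apply: contraT => lk; case: nk.
by exists (vsval k); rewrite ?subvsP // vsvalK.
Qed.

Lemma root_vec_orth al be z w :
  al + be != 0 -> root_vec al z -> root_vec be w -> killing z w = 0.
Proof.
move=> /dual_neq0[k kH abk] zw ww.
have : killing (lie k z) w = - killing z (lie k w).
  by rewrite lieC killingNl killing_lie.
rewrite zw // ww // killingZl killingZr => /eqP.
rewrite -addr_eq0 -mulrDl mulf_eq0 => /orP[|/eqP//].
by move: abk; rewrite add_lfunE => /negPf ->.
Qed.

(** Roots are imaginary on the compact form: invariance moves [tau k] across the nonzero pairing of
    [z] with [tau z], where it acts as the conjugate of [k, z]. *)
Lemma root_cpt_conj al z k : z != 0 -> root_vec al z -> k \in H ->
  (al (vsproj H (tau k)) : C) = - conjc (al (vsproj H k) : C).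
Proof.
move=> z0 zw kH; have nz : killing z (tau z) != 0.
  by apply: contra z0 => /eqP/(cpt_herm_eq0 htheta) ->.
apply: (mulIf nz); rewrite -killingZl -zw ?cpt_conj_cartan // lieC killingNl.
rewrite killing_lie -{1}[k](cpt_conjK htheta) -(cpt_conj_lie htheta).
by rewrite cpt_conjK // zw // cpt_conjZ killingZr mulNr.
Qed.

Lemma root_vec_cpt_conj al z : root_vec al z -> root_vec (- al) (tau z).
Proof.
have [->|z0] := eqVneq z 0.
  have -> : tau 0 = 0 by rewrite /tau linear0 oppr0.
  by move=> _ k kH; rewrite linear0 scaler0.
move=> zw k kH; rewrite -{1}[k](cpt_conjK htheta) -(cpt_conj_lie htheta).
rewrite zw ?cpt_conj_cartan // cpt_conjZ (root_cpt_conj z0 zw kH).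
by rewrite rmorphN /= conjcK opp_lfunE.
Qed.

Lemma root_opp al : root_system al -> root_system (- al).
Proof.
move=> [al0 [z zw]]; split; first by rewrite oppr_eq0.
exists (tau z); apply: root_vec_weight; last exact/root_vec_cpt_conj/weight_root_vec.
by case: zw => + _; apply: contra => /eqP tz; rewrite -[z](cpt_conjK htheta) tz
  /cpt_conj /= linear0 oppr0.
Qed.

Variables h e : dual H -> LC.
Hypothesis he : root_vectors h e.

Lemma root_coroot al k : root_system al -> k \in H ->
  killing k (h al) = (al (vsproj H k) : C).
Proof. by move=> /he[_ E _ _] kH; rewrite -E vsprojK. Qed.

(** The pairing of k in H with the sum [tau (h al) + h al] is al(k) plus the conjugate of al(tau k),
    which is 0. Taking for k the conjugate of the sum itself, definiteness kills it. *)
Lemma cpt_conj_coroot al : root_system al -> tau (h al) = - h al.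
Proof.
move=> ral; have [hH _ ew _] := he ral.
have [e0 _] := ew; have {}ew := weight_root_vec ew.
apply/eqP; rewrite -addr_eq0; apply/eqP/(cpt_herm_eq0 htheta).
set w := _ + h al.
have wH : w \in H by rewrite memvD ?cpt_conj_cartan.
rewrite killingC; set k := tau w; have kH : k \in H by exact: cpt_conj_cartan.
rewrite killingDr root_coroot // -{1}[k](cpt_conjK htheta) (killing_cpt_conj htheta).
rewrite root_coroot ?cpt_conj_cartan // (root_cpt_conj e0 ew kH).
by rewrite rmorphN /= conjcK addNr.
Qed.

Lemma root_coroot_gt0 al : root_system al -> 0 < (al (vsproj H (h al)) : C).
Proof.
move=> ral; have [hH _ _ _] := he ral; have [al0 _] := ral.
rewrite -root_coroot // -[X in killing _ X]opprK -(cpt_conj_coroot ral) killingNr.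
apply: (cpt_herm_gt0 htheta); have [k kH] := dual_neq0 al0.
by rewrite -root_coroot //; apply: contra => /eqP ->; rewrite killing0r.
Qed.

(* Lowering [y'], orthogonal to [E = e al], by [f = tau E] gives zero, so that
   |[E, y']|^2 = (y', [f, [E, y']]) is - al (h al) |E|^2 |y'|^2 < 0. *)

Lemma root_vec_mult1 al y : root_system al -> root_vec al y ->
  exists c : C, y = c *: e al.
Proof.
move=> ral yw; have [hH _ [E0 Ew] _] := he ral.
have {}Ew : root_vec al (e al) by apply: weight_root_vec.
set E := e al in E0 Ew *.
pose c := killing y (tau E) / killing E (tau E); exists c.
apply/eqP; rewrite -subr_eq0; apply: contraT => y0; set y' := y - c *: E in y0.
have EE : 0 < - killing E (tau E) := cpt_herm_gt0 htheta E0.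
have EE0 : killing E (tau E) != 0 by rewrite -oppr_eq0 gt_eqF.
have yE : killing y' (tau E) = 0.
  by rewrite killingDl killingNl killingZl /c divfK // subrr.
have {}yw : root_vec al y'.
  move=> k kH; rewrite lieDr lieNr lieZr yw // Ew // scalerBr.
  by rewrite !scalerA mulrC.
have fw := root_vec_cpt_conj Ew; set f := tau E in fw yE EE EE0.
have zeroH u v : root_vec (- al) u -> root_vec al v -> lie u v \in H.
  move=> uw vw; apply: cartan_self_centralizing => k kH.
  rewrite lie_derivation (uw k kH) (vw k kH) lieZl lieZr opp_lfunE scaleNr.
  by rewrite addNr.
(* This bracket lies in H, hence so does its conjugate, which acts on [y'] by a scalar; by
   invariance the Hermitian norm of the bracket is a multiple of B(y', f) = 0. *)
have fy : lie f y' = 0.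
  apply: (cpt_herm_eq0 htheta); rewrite killing_lie.
  rewrite [lie y' _]lieC yw ?cpt_conj_cartan ?zeroH //.
  by rewrite killingNr killingZr [killing f y']killingC yE mulr0 oppr0.
pose w := lie E y'.
have wE : killing w (tau w) =
    (al (vsproj H (h al)) : C) * killing E f * killing y' (tau y').
  rewrite /w (cpt_conj_lie htheta) -/f -killing_lie lieC lie_derivation fy.
  rewrite lie0r addr0 yw ?zeroH // -root_coroot ?zeroH //.
  rewrite killing_lie [lie E _]lieC Ew // killingNr killingZr scaleNr opprK.
  by rewrite killingZl [killing f E]killingC.
have : 0 <= - killing w (tau w).
  have [->|/(cpt_herm_gt0 htheta)/ltW//] := eqVneq w 0.
  by rewrite killing0l oppr0.
move=> /le_gtF <-; rewrite wE oppr_lt0 -mulrA mulr_gt0 ?root_coroot_gt0 //.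
by rewrite -mulrNN mulr_gt0 // (cpt_herm_gt0 htheta).
Qed.

End Roots.

Lemma linfunE (K : fieldType) (V W : vectType K) (f : V -> W) :
  linear f -> linfun f =1 f.
Proof.
move=> fl x.
pose F : {linear V -> W} := HB.pack f (GRing.isLinear.Build _ _ _ _ f fl).
by rewrite -[f]/(F : V -> W) lfunE.
Qed.

Lemma dual_bases_sum (K : fieldType) (L : lieAlgType K) n (U : {vspace L})
    (b b' : n.-tuple L) x : dual_bases U b b' -> x \in U ->
  \sum_s killing x (tnth b' s) *: tnth b s = x.
Proof.
case=> bB _ bb' xU; rewrite [RHS](coord_basis bB xU).
apply: eq_bigr => s _; rewrite -tnth_nth; congr (_ *: _).
rewrite {1}(coord_basis bB xU) killing_suml (bigD1 s) //= big1 => [|j js].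
  by rewrite addr0 -tnth_nth killingZl bb' eqxx mulr1.
by rewrite -tnth_nth killingZl bb' (negPf js) mulr0.
Qed.

Lemma dual_basesC (K : fieldType) (L : lieAlgType K) n (U : {vspace L})
    (b b' : n.-tuple L) : dual_bases U b b' -> dual_bases U b' b.
Proof. by case=> bB bB' bb'; split=> // i j; rewrite killingC bb' eq_sym. Qed.

Lemma basis_tnth_mem (K : fieldType) (L : vectType K) n (U : {vspace L})
    (b : n.-tuple L) s : basis_of U b -> tnth b s \in U.
Proof. by move=> bB; apply/(basis_mem bB)/mem_tnth. Qed.

(** * Weights with respect to a alone, and restriction of roots to a *)

Section RestrictedWeights.
Variables (R : realType) (L : lieAlgType R) (theta : 'End(L)).
Hypothesis htheta : cartan_involution theta.
Variables (a t : {vspace L}).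
Hypothesis ha : maximal_abelian_in a (p_space theta).
Hypothesis ht : maximal_abelian_in t (m_space theta a).
Local Notation LC := (cplx L).
Local Notation C := R[i].
Local Notation tau := (cpt_conj theta).
Local Notation H := (cartan a t).
Local Notation m := (m_space theta a).
Implicit Types (z w k : LC) (al be : dual H) (l : dual a).

(** The zero vector and the weight 0 are both allowed, so m, a and the restricted root spaces are
    handled by the same lemmas. *)
Definition a_weight l z := forall y, y \in a ->
  lie (cplx_of y) z = (l (vsproj a y) : R)%:C *: z.

Lemma a_weight_orth l l' z w :
  l + l' != 0 -> a_weight l z -> a_weight l' w -> killing z w = 0.
Proof.
move=> /dual_neq0[k kH abk] zw ww.
have : killing (lie (cplx_of k) z) w = - killing z (lie (cplx_of k) w).
  by rewrite lieC killingNl killing_lie.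
rewrite zw // ww // killingZl killingZr => /eqP.
rewrite -addr_eq0 -mulrDl -rmorphD mulf_eq0 => /orP[|/eqP//].
rewrite fmorph_eq0; by move: abk; rewrite add_lfunE => /negPf ->.
Qed.

Lemma a_weight_theta l z : a_weight l z -> a_weight (- l) (cplx_end theta z).
Proof.
have thetaL : lie_endo theta by case: htheta.
move=> zw y ya.
rewrite -[lie _ _](cplx_thetaK htheta) (cplx_end_lie thetaL) (cplx_thetaK htheta).
have -> : cplx_end theta (cplx_of y) = - cplx_of y.
  by rewrite cplx_endE /= linear0 (theta_a ha ya); congr pair; rewrite /= oppr0.
by rewrite lieNl zw // linearN linearZ /= opp_lfunE rmorphN scaleNr.
Qed.

Lemma a_weight_a z : z \in cplx_sub a -> a_weight 0 z.
Proof.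
rewrite mem_cplx_sub => /andP[z1 z2] y ya; rewrite lie_cplx_of.
by rewrite zero_lfunE scale0r; congr pair; rewrite (abelian_a ha).
Qed.

Lemma a_weight_m z : z \in cplx_sub m -> a_weight 0 z.
Proof.
rewrite mem_cplx_sub => /andP[/mem_m_space[_ z1] /mem_m_space[_ z2]] y ya.
by rewrite lie_cplx_of zero_lfunE scale0r; congr pair; rewrite ?z1 ?z2.
Qed.

Lemma a_weight0 z : a_weight 0 z -> z \in (cplx_sub m + cplx_sub a)%VS.
Proof.
move=> zw.
have zc y : y \in a -> lie y z.1 = 0 /\ lie y z.2 = 0.
  by move=> /zw; rewrite lie_cplx_of zero_lfunE scale0r => -[].
have [y /zc[]//|u1 [v1 [u1m v1a e1]]] := centralizer_a htheta ha (x := z.1).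
have [y /zc[]//|u2 [v2 [u2m v2a e2]]] := centralizer_a htheta ha (x := z.2).
have -> : z = ((u1, u2) : LC) + ((v1, v2) : LC).
  by case: z e1 e2 {zw zc} => z1 z2 /= -> ->.
by rewrite memv_add // mem_cplx_sub /= ?u1m ?u2m ?v1a ?v2a.
Qed.

Lemma killing_m_a z w : z \in cplx_sub m -> w \in cplx_sub a -> killing z w = 0.
Proof.
rewrite !mem_cplx_sub => /andP[/mem_m_space[z1 _] /mem_m_space[z2 _]] /andP[w1 w2].
have E x y : theta x = x -> y \in a -> killing x y = 0.
  move=> xk ya.
  have := killing_theta htheta x y; rewrite xk (theta_a ha ya) killingNr.
  by move=> /eqP; rewrite -addr_eq0 -mulr2n mulrn_eq0 => /eqP.
by rewrite killing_cplxE !E // subr0 addr0.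
Qed.

(** Taking the real part makes this a real functional for every [al]; on roots it loses nothing, by
    [root_restr]. *)
Definition restr al : dual a :=
  linfun (fun x : subvs_of a => complex.Re (al (vsproj H (cplx_of (vsval x))) : C)).

Lemma restrE al x :
  restr al x = complex.Re (al (vsproj H (cplx_of (vsval x))) : C).
Proof.
rewrite linfunE // => k y z; rewrite linearP cplx_ofD cplx_ofZ !linearP /=.
by case: (al _) => p q; case: (al _) => p' q'; rewrite /= mul0r subr0.
Qed.

Lemma restrN al : restr (- al) = - restr al.
Proof.
by apply/lfunP => x; rewrite opp_lfunE !restrE opp_lfunE; case: (al _).
Qed.

Lemma cplx_of_a_cartan y : y \in a -> cplx_of y \in H.
Proof. by move=> ya; rewrite mem_cplx_of (subvP (addvSr _ _)). Qed.

(** The conjugation [tau] negates a, so [root_cpt_conj] says that the value is its own conjugate. *)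
Lemma root_restr al y : root_system al -> y \in a ->
  (al (vsproj H (cplx_of y)) : C) = (restr al (vsproj a y) : R)%:C.
Proof.
move=> [_ [z zw]] ya; rewrite restrE vsprojK //.
have [z0 _] := zw; have kH := cplx_of_a_cartan ya.
have := root_cpt_conj htheta ha ht z0 (weight_root_vec zw) kH.
have -> : tau (cplx_of y) = - cplx_of y.
  by congr pair; rewrite /= ?(theta_a ha ya) ?linear0.
rewrite !linearN /= => /oppr_inj; case: (al _) => p q [/eqP].
by rewrite -addr_eq0 -mulr2n mulrn_eq0 => /eqP ->.
Qed.

Lemma roots_overP l al :
  @roots_over R L a t l al <-> root_system al /\ restr al = l.
Proof.
split=> -[ral E]; split=> //.
  by apply/lfunP => x; rewrite restrE E.
by move=> x; rewrite root_restr ?subvsP // vsvalK E.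
Qed.

Lemma root_vec_a_weight al z : root_system al -> root_vec al z -> a_weight (restr al) z.
Proof.
by move=> ral zw y ya; rewrite zw ?cplx_of_a_cartan // root_restr.
Qed.

(** The real space a acts on the real and imaginary parts of [z] separately, with the same real
    eigenvalues, and one of these parts is nonzero. *)
Lemma a_weight_restricted_root l z : z != 0 -> l != 0 -> a_weight l z ->
  restricted_roots l.
Proof.
move=> z0 l0 zw; split=> //.
have zw' (x : subvs_of a) : lie (vsval x) z.1 = (l x : R) *: z.1 /\
    lie (vsval x) z.2 = (l x : R) *: z.2.
  have := zw (vsval x) (subvsP _); rewrite lie_cplx_of vsvalK cplxZE /=.
  by rewrite !scale0r subr0 addr0 => -[].
have [z1|z1] := eqVneq z.1 0.
  exists z.2; split; last by move=> x; case: (zw' x).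
  by apply: contra z0 => /eqP z2; case: z z1 z2 {zw zw'} => x y /= -> ->.
by exists z.1; split=> // x; case: (zw' x).
Qed.

Lemma restricted_root_weight l : restricted_roots l ->
  exists2 x, x != 0 & a_weight l (cplx_of x).
Proof.
move=> [_ [x [x0 xw]]]; exists x => // y ya.
by rewrite -cplx_of_lie -cplx_ofZ -xw vsprojK.
Qed.

Lemma restricted_root_opp l : restricted_roots l -> restricted_roots (- l).
Proof.
move=> rl; have [l0 _] := rl; have [x x0 /a_weight_theta xw] := restricted_root_weight rl.
apply: a_weight_restricted_root xw; last by rewrite oppr_eq0.
apply: contra x0 => /eqP /(congr1 (cplx_end theta)).
by rewrite (cplx_thetaK htheta) linear0 => -[->].
Qed.

Lemma restricted_roots_finite : finite_set (@restricted_roots R L a).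
Proof.
pose v l : LC := cplx_of (xget 0 [set x | x != 0 /\ a_weight l (cplx_of x)]).
have vP l : restricted_roots l -> v l != 0 /\ a_weight l (v l).
  move=> /restricted_root_weight[x x0 xw]; rewrite /v; case: xgetP => [y _ [y0 yw]|/(_ x)].
    by split=> //; apply: contra y0 => /eqP[->].
  by case.
(* [tau (v l)] has weight -l, so it is orthogonal to the vectors of the other weights; its pairing
   with [v l] is a Hermitian norm up to sign. *)
apply: (@finite_dual_family _ _ _ _ v (fun l => killing (tau (v l)))).
  move=> l /vP[v0 _]; rewrite /= killingC.
  by apply: contra v0 => /eqP/(cpt_herm_eq0 htheta) ->.
move=> l l' /vP[_ vl] /vP[_ vl'] ll'.
apply: (@a_weight_orth (- l) l') => //; first by rewrite addrC subr_eq0 eq_sym.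
have -> : tau (v l) = cplx_end theta (v l) by rewrite cplx_endE /cpt_conj /= linear0 oppr0.
exact: a_weight_theta.
Qed.

Lemma finite_roots (h e : dual H -> LC) : root_vectors h e ->
  finite_set (@root_system R L a t).
Proof.
move=> he; apply: (@finite_dual_family _ _ _ _ e (fun al => killing (tau (e al)))).
  move=> al /he[_ _ [e0 _] _]; rewrite /= killingC.
  by apply: contra e0 => /eqP/(cpt_herm_eq0 htheta) ->.
move=> al be /he[_ _ /weight_root_vec ew _] /he[_ _ /weight_root_vec ew' _] ab.
apply: (@root_vec_orth _ _ _ _ (- al) be) => //.
  by rewrite addrC subr_eq0 eq_sym.
exact: (root_vec_cpt_conj htheta ha ht).
Qed.

End RestrictedWeights.

(** * Completeness of the root vectors *)

Section Completeness.
Variables (R : realType) (L : lieAlgType R) (theta : 'End(L)).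
Hypothesis htheta : cartan_involution theta.
Variables (a t : {vspace L}).
Hypothesis ha : maximal_abelian_in a (p_space theta).
Hypothesis ht : maximal_abelian_in t (m_space theta a).
Local Notation LC := (cplx L).
Local Notation C := R[i].
Local Notation tau := (cpt_conj theta).
Local Notation H := (cartan a t).
Local Notation m := (m_space theta a).
Variables h e : dual H -> LC.
Hypothesis he : root_vectors h e.
Variables (r : nat) (x : r.-tuple L).
Hypothesis hx : orthonormal_basis theta a x.
Variables (d : nat) (c c' : d.-tuple LC).
Hypothesis hc : dual_bases (cplx_sub m) c c'.
Implicit Types (z w k : LC) (al be : dual H) (l : dual a).

Lemma root_vec_e al : root_system al -> root_vec al (e al).
Proof. by move=> /he[_ _ /weight_root_vec]. Qed.

(** The normalization of the brackets forces this: for k with al(k) nonzero, al(k) times the pairing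
    is B(k, [e_al, e_(-al)]) = B(k, h_al) = al(k). *)
Lemma killing_root_pair al : root_system al -> killing (e al) (e (- al)) = 1.
Proof.
move=> ral; have [_ _ _ E] := he ral; have [al0 _] := ral.
have [k kH alk] := dual_neq0 al0; apply: (mulfI alk); rewrite mulr1.
rewrite -killingZl -(root_vec_e ral kH) killing_lie E.
exact: (root_coroot he).
Qed.

Lemma killing_roots al be : root_system al -> root_system be ->
  killing (e al) (e be) = (be == - al)%:R.
Proof.
move=> ral rbe; have [->|nab] := eqVneq; first exact: killing_root_pair.
apply: root_vec_orth (root_vec_e ral) (root_vec_e rbe).
by rewrite addrC addr_eq0.
Qed.

Lemma tens_op_varpi_m z :
  tens_op (varpi_m c c') z = \sum_s killing z (tnth c' s) *: tnth c s.
Proof. by rewrite tens_op_sum; apply: eq_bigr => s _; rewrite tens_op_tens. Qed.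

Lemma tens_op_sum_xx z : tens_op (sum_xx x) z =
  \sum_j killing z (cplx_of (tnth x j)) *: cplx_of (tnth x j).
Proof. by rewrite tens_op_sum; apply: eq_bigr => s _; rewrite tens_op_tens. Qed.

Lemma tens_op_varpi_m_id z : z \in cplx_sub m -> tens_op (varpi_m c c') z = z.
Proof. by move=> zm; rewrite tens_op_varpi_m (dual_bases_sum hc). Qed.

Lemma tens_op_varpi_m0 z : (forall w, w \in cplx_sub m -> killing z w = 0) ->
  tens_op (varpi_m c c') z = 0.
Proof.
move=> z0; rewrite tens_op_varpi_m big1 // => s _; rewrite z0 ?scale0r //.
by case: hc => _ cB _; exact: basis_tnth_mem.
Qed.

Lemma tens_op_varpi_m_mem z : tens_op (varpi_m c c') z \in cplx_sub m.
Proof.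
rewrite tens_op_varpi_m; apply: memv_suml => s _; apply: memvZ.
by case: hc => cB _ _; exact: basis_tnth_mem.
Qed.

Lemma mem_x j : tnth x j \in a.
Proof. by case: hx => xB _; exact: basis_tnth_mem. Qed.

Lemma killing_x i j : killing (tnth x i) (tnth x j) = (i == j)%:R.
Proof.
case: hx => _ /(_ i j).
rewrite (theta_a ha (mem_x j)) killing_cplx_of killingNr rmorphN opprK.
by move=> /(congr1 (@complex.Re R)) /= ->; case: (i == j).
Qed.

Lemma tens_op_sum_xx_id z : z \in cplx_sub a -> tens_op (sum_xx x) z = z.
Proof.
have E y : y \in a -> tens_op (sum_xx x) (cplx_of y) = cplx_of y.
  case: hx => xB _ ya; rewrite tens_op_sum_xx.
  transitivity (cplx_of (\sum_j killing y (tnth x j) *: tnth x j)).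
    rewrite (big_morph _ (@cplx_ofD _ L) (erefl _ : cplx_of 0 = 0)).
    by apply: eq_bigr => j _; rewrite killing_cplx_of cplx_ofZ.
  by congr cplx_of; apply: (dual_bases_sum _ ya); split=> // i j; rewrite killing_x.
rewrite mem_cplx_sub => /andP[z1 z2].
by rewrite {1}[z]cplxE linearD linearZ /= !E // -cplxE.
Qed.

Lemma tens_op_sum_xx0 z : (forall w, w \in cplx_sub a -> killing z w = 0) ->
  tens_op (sum_xx x) z = 0.
Proof.
move=> z0; rewrite tens_op_sum_xx big1 // => s _; rewrite z0 ?scale0r //.
by rewrite mem_cplx_of mem_x.
Qed.

Lemma tens_op_sum_xx_mem z : tens_op (sum_xx x) z \in cplx_sub a.
Proof.
rewrite tens_op_sum_xx; apply: memv_suml => s _; apply: memvZ.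
by rewrite mem_cplx_of mem_x.
Qed.

(** Roots vanishing on a are left out: their root vectors centralize a and are already accounted for
    by m + a. *)
Let nz := [seq al <- fset_set (@root_system R L a t) | restr al != 0].

Lemma mem_nz al : reflect (root_system al /\ restr al != 0) (al \in nz).
Proof.
rewrite mem_filter in_fset_set; last exact: (finite_roots htheta ha ht he).
by apply: (iffP andP) => -[? ?]; split=> //; [exact: set_mem|exact: mem_set].
Qed.

Lemma killing_e_a_weight0 al z : root_system al -> restr al != 0 ->
  a_weight (0 : dual a) z -> killing z (e al) = 0.
Proof.
move=> ral al0 zw; apply: (a_weight_orth _ zw); last first.
  exact: (root_vec_a_weight htheta ha ht ral (root_vec_e ral)).
by rewrite add0r.
Qed.

Definition root_tensor : tensor LC := \sum_(al <- nz) tens (e (- al)) (e al).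
(** A candidate for the tensor of the Casimir element: its operator being the identity expresses
    that m, a and the root vectors span g. *)
Definition casimir_tensor : tensor LC := varpi_m c c' + sum_xx x + root_tensor.
Local Notation S := casimir_tensor.

Lemma tens_op_root_tensor z :
  tens_op root_tensor z = \sum_(al <- nz) killing z (e al) *: e (- al).
Proof. by rewrite tens_op_sum; apply: eq_bigr => al _; rewrite tens_op_tens. Qed.

Lemma tens_op_root_tensor0 z : a_weight (0 : dual a) z -> tens_op root_tensor z = 0.
Proof.
move=> zw; rewrite tens_op_root_tensor big_seq big1 // => al /mem_nz[ral al0].
by rewrite killing_e_a_weight0 ?scale0r.
Qed.

Lemma killing_root_tensor0 z u : a_weight (0 : dual a) u ->
  killing (tens_op root_tensor z) u = 0.
Proof.
move=> uw; rewrite tens_op_root_tensor killing_suml big_seq big1 // => al.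
move=> /mem_nz[ral al0]; rewrite killingZl [killing (e _) u]killingC.
rewrite (@killing_e_a_weight0 (- al) u) ?mulr0 ?restrN ?oppr_eq0 //.
exact: (root_opp htheta ha ht).
Qed.

Lemma tens_op_root_tensor_e be : root_system be -> restr be != 0 ->
  tens_op root_tensor (e be) = e be.
Proof.
move=> rbe be0; rewrite tens_op_root_tensor.
have bnz : - be \in nz.
  apply/mem_nz; split; first exact: (root_opp htheta ha ht).
  by rewrite restrN oppr_eq0.
rewrite (bigD1_seq (- be)) ?filter_uniq ?fset_uniq //= big_seq_cond big1 => [|al].
  by rewrite addr0 killing_roots ?eqxx ?scale1r ?opprK //; case/mem_nz: bnz.
by move=> /andP[/mem_nz[ral _] /negPf alb]; rewrite killing_roots // alb scale0r.
Qed.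

Let W := (cplx_sub m + cplx_sub a + <<[seq e al | al <- nz]>>)%VS.

Lemma casimir_tensor_W z : z \in W -> tens_op S z = z.
Proof.
move=> zW; suff : z \in lker (linfun (tens_op S) - \1)%VF.
  by rewrite memv_ker !lfun_simp ?lfunE /= subr_eq0 => /eqP.
apply: subvP zW; rewrite !subv_add -andbA; apply/and3P; split.
- apply/subvP => w wm; rewrite memv_ker !lfun_simp ?lfunE /= subr_eq0.
  rewrite !tens_opD tens_op_varpi_m_id // tens_op_root_tensor0; last exact: a_weight_m wm.
  rewrite tens_op_sum_xx0 ?addr0 // => w' w'a.
  exact: (killing_m_a htheta ha).
- apply/subvP => w wa; rewrite memv_ker !lfun_simp ?lfunE /= subr_eq0.
  rewrite !tens_opD tens_op_sum_xx_id // tens_op_root_tensor0; last exact: (a_weight_a ha wa).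
  rewrite tens_op_varpi_m0 ?add0r ?addr0 // => w' w'm.
  by rewrite killingC; exact: (killing_m_a htheta ha).
- apply/span_subvP => _ /mapP[al /mem_nz[ral al0] ->].
  rewrite memv_ker !lfun_simp ?lfunE /= subr_eq0.
  rewrite !tens_opD tens_op_root_tensor_e // tens_op_varpi_m0 => [|w wm].
    rewrite tens_op_sum_xx0 ?add0r // => w wa.
    by rewrite killingC killing_e_a_weight0 //; exact: (a_weight_a ha wa).
  by rewrite killingC killing_e_a_weight0 //; exact: a_weight_m wm.
Qed.

Lemma casimir_tensor_mem z : tens_op S z \in W.
Proof.
rewrite !tens_opD memv_add ?memv_add ?tens_op_varpi_m_mem ?tens_op_sum_xx_mem //.
rewrite tens_op_root_tensor big_seq; apply: memv_suml => al /mem_nz[ral al0].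
apply/memvZ/memv_span/map_f/mem_nz; split; first exact: (root_opp htheta ha ht).
by rewrite restrN oppr_eq0.
Qed.

(** Together with the two preceding lemmas this makes [tens_op S] the Killing-orthogonal projection
    onto [W]. *)
Lemma killing_casimir_tensor z w : w \in W -> killing (tens_op S z) w = killing z w.
Proof.
move=> wW; apply/eqP; rewrite -subr_eq0 -killingNl -killingDl.
suff : w \in lker (linfun (killing (tens_op S z - z) : LC -> C^o)) by rewrite memv_ker lfunE.
apply: subvP wW; rewrite !subv_add -andbA; apply/and3P; split.
- apply/subvP => u um; rewrite memv_ker lfunE /= killingDl killingNl subr_eq0.
  rewrite !tens_opD !killingDl.
  rewrite [X in _ + X + _](_ : _ = 0); last first.
    by rewrite killingC (killing_m_a htheta ha) // tens_op_sum_xx_mem.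
  rewrite [X in _ + _ + X](_ : _ = 0) ?addr0; last first.
    by apply: killing_root_tensor0; exact: a_weight_m um.
  apply/eqP; rewrite tens_op_varpi_m killing_suml.
  rewrite -[in RHS](dual_bases_sum (dual_basesC hc) um) killing_sumr.
  by apply: eq_bigr => s _; rewrite killingZl killingZr [killing u _]killingC mulrC.
- apply/subvP => u ua; rewrite memv_ker lfunE /= killingDl killingNl subr_eq0.
  rewrite !tens_opD !killingDl.
  rewrite [X in X + _ + _](_ : _ = 0); last first.
    by rewrite (killing_m_a htheta ha) // tens_op_varpi_m_mem.
  rewrite [X in _ + _ + X](_ : _ = 0) ?addr0 ?add0r; last first.
    by apply: killing_root_tensor0; exact: (a_weight_a ha ua).
  apply/eqP; rewrite tens_op_sum_xx killing_suml.
  rewrite -[in RHS](tens_op_sum_xx_id ua) tens_op_sum_xx killing_sumr.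
  by apply: eq_bigr => s _; rewrite killingZl killingZr [killing u _]killingC mulrC.
- apply/span_subvP => _ /mapP[be /mem_nz[rbe be0] ->].
  rewrite memv_ker lfunE /= killingDl killingNl subr_eq0.
  rewrite !tens_opD !killingDl killing_e_a_weight0 //; last first.
    by apply: (a_weight_m); exact: tens_op_varpi_m_mem.
  rewrite killing_e_a_weight0 //; last first.
    by apply: (a_weight_a ha); exact: tens_op_sum_xx_mem.
  rewrite !add0r tens_op_root_tensor killing_suml.
  rewrite (bigD1_seq be) ?filter_uniq ?fset_uniq //=; last exact/mem_nz.
  rewrite killingZl killing_roots ?opprK ?eqxx ?mulr1 //; last exact: (root_opp htheta ha ht).
  rewrite big_seq_cond big1 ?addr0 // => al /andP[/mem_nz[ral _] alb].
  rewrite killingZl killing_roots ?opprK //; last exact: (root_opp htheta ha ht).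
  by rewrite eq_sym (negPf alb) mulr0.
Qed.

Lemma cartan_stable_W k w : k \in H -> w \in W -> lie k w \in W.
Proof.
move=> kH wW; suff : w \in (ad k @^-1: W)%VS by rewrite -memv_preim adE.
apply: subvP wW; rewrite !subv_add -andbA; apply/and3P; split.
- apply/subvP => u um; rewrite -memv_preim adE; apply: (subvP (addvSl _ _)).
  apply: (subvP (addvSl _ _)); move: kH um; rewrite !mem_cplx_sub /=.
  move=> /andP[k1 k2] /andP[u1 u2].
  have E y v : y \in (t + a)%VS -> v \in m -> lie y v \in m.
    move=> /memv_addP[y1 y1t [y2 y2a ->]] /mem_m_space[v1 v2].
    rewrite lieDl (v2 y2) // addr0; have [y11 y12] := t_sub_m ht y1t.
    apply/mem_m_space; split; first by case: htheta => -> _ _; rewrite v1 y11.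
    move=> z za; rewrite lie_derivation (y12 z) // (v2 z) //.
    by rewrite lie0r lie0l addr0.
  by rewrite memvB ?memvD ?E.
- apply/subvP => u ua; rewrite -memv_preim adE (cartan_abelian ha ht) ?mem0v //.
  by move: ua; rewrite !mem_cplx_sub => /andP[u1 u2]; rewrite !(subvP (addvSr _ _)).
- apply/span_subvP => _ /mapP[al /[dup] alnz /mem_nz[ral al0] ->].
  rewrite -memv_preim adE (root_vec_e ral kH) (subvP (addvSr _ _)) //.
  by apply/memvZ/memv_span/map_f.
Qed.

(** The eigenvalues form a functional on H. If it vanishes on a, then [v] is in m + a; otherwise it
    is a root, and its root space is the line through the given root vector. *)
Lemma cartan_eigenvector_W v : v != 0 ->
  (forall k, k \in H -> exists q : C, lie k v = q *: v) -> v \in W.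
Proof.
move=> v0 vE; have vv : killing (tau v) v != 0.
  by rewrite killingC; apply: contra v0 => /eqP/(cpt_herm_eq0 htheta) ->.
(* A Rayleigh quotient: it returns the eigenvalue of k on [v] and is visibly linear in k. *)
pose f (k : subvs_of H) := killing (tau v) (lie (vsval k) v) / killing (tau v) v.
have fl : linear (f : _ -> C^o).
  move=> q y z; rewrite /f linearP /= lieDl lieZl killingDr killingZr mulrDl.
  by rewrite -mulrA.
pose al : dual H := linfun (f : _ -> C^o).
have alE k : k \in H -> lie k v = (al (vsproj H k) : C) *: v.
  move=> kH; rewrite linfunE // /f vsprojK //; have [q ->] := vE k kH.
  by rewrite killingZr mulfK.
have [va|va] := pselect (a_weight (0 : dual a) v).
  by apply: (subvP (addvSl _ _)); exact: (a_weight0 htheta ha).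
have al0 : al != 0.
  apply/eqP => al0; apply: va => y ya; rewrite alE ?cplx_of_a_cartan //.
  by rewrite al0 !zero_lfunE !scale0r.
have ral : root_system al.
  by split=> //; exists v; apply: root_vec_weight.
have [q ->] := root_vec_mult1 htheta ha ht he ral alE.
apply: (subvP (addvSr _ _)); apply/memvZ/memv_span/map_f/mem_nz; split=> //.
apply/eqP => al00; apply: va; rewrite -al00.
exact: (root_vec_a_weight htheta ha ht).
Qed.

(* The kernel of [tens_op S] is the orthogonal of [W], hence stable under the
   Cartan subalgebra; a common eigenvector in it would lie in [W], where
   [tens_op S] is the identity. *)

Lemma casimir_tensor_id z : tens_op S z = z.
Proof.
suff kerS : lker (linfun (tens_op S)) = 0%VS.
  (* Injectivity is enough, because the operator is idempotent: its values lie in [W], where it is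
     the identity. *)
  have /lker0P inj : lker (linfun (tens_op S)) == 0%VS by rewrite kerS.
  by apply: inj; rewrite !lfunE /= casimir_tensor_W ?casimir_tensor_mem.
apply/eqP; apply: contraT => ker0.
have kerP w : reflect (forall u, u \in W -> killing w u = 0)
    (w \in lker (linfun (tens_op S))).
  rewrite memv_ker lfunE; apply: (iffP eqP) => /= [w0 u uW|w0].
    by rewrite -killing_casimir_tensor // w0 killing0l.
  rewrite !tens_opD tens_op_varpi_m0 => [|u um]; last first.
    by apply/w0/(subvP (addvSl _ _))/(subvP (addvSl _ _)).
  rewrite tens_op_sum_xx0 => [|u ua]; last first.
    by apply/w0/(subvP (addvSl _ _))/(subvP (addvSr _ _)).
  rewrite !add0r tens_op_root_tensor big_seq big1 // => al alnz.
  rewrite w0 ?scale0r //; apply: (subvP (addvSr _ _)).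
  exact/memv_span/map_f.
have [| |v [vker v0 vE]] := @common_eigenvector_in _ _ [seq ad k | k <- vbasis H] _ ker0.
- move=> _ w /mapP[k /vbasis_mem kH ->] /kerP w0; rewrite adE; apply/kerP => u uW.
  by rewrite lieC killingNl killing_lie w0 ?oppr0 ?cartan_stable_W.
- move=> _ _ w /mapP[k /vbasis_mem kH ->] /mapP[k' /vbasis_mem k'H ->].
  by rewrite !adE lie_derivation (cartan_abelian ha ht kH k'H) lie0l add0r.
suff vW : v \in W.
  by move: vker v0; rewrite memv_ker lfunE /= casimir_tensor_W // => ->.
apply: cartan_eigenvector_W => // k kH.
rewrite (coord_vbasis kH).
elim/big_ind: _ => [|y y' [p Ep] [q Eq]|i _].
- by exists 0; rewrite lie0l scale0r.
- by exists (p + q); rewrite lieDl Ep Eq scalerDl.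
- have [|q] := vE (ad (vbasis H)`_i).
    by apply/map_f/mem_nth; rewrite size_tuple.
  rewrite adE => Eq; exists (coord (vbasis H) i k * q).
  by rewrite lieZl Eq scalerA.
Qed.

End Completeness.

(** * The invariant tensors as projections onto weight spaces *)

Section Varpi.
Variables (R : realType) (L : lieAlgType R) (theta : 'End(L)).
Hypothesis htheta : cartan_involution theta.
Variables (a t : {vspace L}).
Hypothesis ha : maximal_abelian_in a (p_space theta).
Hypothesis ht : maximal_abelian_in t (m_space theta a).
Local Notation LC := (cplx L).
Local Notation C := R[i].
Local Notation tau := (cpt_conj theta).
Local Notation H := (cartan a t).
Local Notation m := (m_space theta a).
Variables h e : dual H -> LC.
Hypothesis he : root_vectors h e.
Variables (r : nat) (x : r.-tuple L).
Hypothesis hx : orthonormal_basis theta a x.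
Variables (d : nat) (c c' : d.-tuple LC).
Hypothesis hc : dual_bases (cplx_sub m) c c'.
Implicit Types (z w k : LC) (al be : dual H) (l : dual a) (T : tensor LC).
Local Notation varpi := (varpi (t := t) e).
Local Notation Sigma := (@restricted_roots R L a).

Lemma finite_roots_over l : finite_set (@roots_over R L a t l).
Proof.
by apply: sub_finite_set (finite_roots htheta ha ht he) => al [].
Qed.

Lemma varpiE l :
  varpi l = \sum_(al <- fset_set (@roots_over R L a t l)) tens (e (- al)) (e al).
Proof. by rewrite /varpi fsbig_finite //; exact: finite_roots_over. Qed.

Lemma mem_roots_over l al :
  al \in fset_set (@roots_over R L a t l) -> root_system al /\ restr al = l.
Proof.
rewrite in_fset_set; last exact: finite_roots_over.
by move=> /set_mem/(roots_overP htheta ha ht).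
Qed.

Lemma tens_op_varpi l z : tens_op (varpi l) z =
  \sum_(al <- fset_set (@roots_over R L a t l)) killing z (e al) *: e (- al).
Proof.
by rewrite varpiE tens_op_sum; apply: eq_bigr => al _; rewrite tens_op_tens.
Qed.

Lemma tens_op_varpi0 l l' z : l' + l != 0 -> a_weight l' z -> tens_op (varpi l) z = 0.
Proof.
move=> ll zw; rewrite tens_op_varpi big_seq big1 // => al /mem_roots_over[ral E].
rewrite (a_weight_orth ll zw) ?scale0r // -E.
exact: (root_vec_a_weight htheta ha ht ral (root_vec_e he ral)).
Qed.

Lemma killing_weight0_m l z w : l != 0 -> a_weight l z -> w \in cplx_sub m ->
  killing z w = 0.
Proof.
by move=> l0 zw /a_weight_m; apply: a_weight_orth zw; rewrite addr0.
Qed.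

Lemma killing_weight0_a l z w : l != 0 -> a_weight l z -> w \in cplx_sub a ->
  killing z w = 0.
Proof.
by move=> l0 zw /(a_weight_a ha); apply: a_weight_orth zw; rewrite addr0.
Qed.

(** [casimir_tensor_id] reproduces [z], and by orthogonality only the roots over [l] contribute to
    it. *)
Lemma tens_op_varpi_id l z : l != 0 -> a_weight (- l) z -> tens_op (varpi l) z = z.
Proof.
move=> l0 zw; have nl0 : - l != 0 by rewrite oppr_eq0.
rewrite -[RHS](casimir_tensor_id htheta ha ht he hx hc) !tens_opD.
rewrite (tens_op_varpi_m0 hc) => [|w wm]; last exact: (killing_weight0_m nl0 zw wm).
rewrite (tens_op_sum_xx0 hx) ?add0r => [|w wa]; last exact: (killing_weight0_a nl0 zw wa).
rewrite tens_op_root_tensor tens_op_varpi.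
rewrite [RHS](bigID (fun al => restr al == l)) /= [X in _ + X]big_seq_cond.
rewrite [X in _ + X]big1 ?addr0 => [|al /andP[/(mem_nz htheta ha ht he)[ral al0] nal]].
  rewrite -[RHS]big_filter; apply: perm_big; apply: uniq_perm.
  - exact: fset_uniq.
  - by rewrite !filter_uniq ?fset_uniq.
  move=> al; rewrite mem_filter; apply/idP/idP => [/mem_roots_over[ral E]|].
    by rewrite E eqxx; apply/(mem_nz htheta ha ht he); rewrite E.
  move=> /andP[/eqP E /(mem_nz htheta ha ht he)[ral al0]].
  rewrite in_fset_set; last exact: finite_roots_over.
  by apply: mem_set; apply/(roots_overP htheta ha ht).
rewrite (a_weight_orth _ zw (root_vec_a_weight htheta ha ht ral (root_vec_e he ral))).
  by rewrite scale0r.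
by rewrite addrC subr_eq0.
Qed.

(** [casimir_tensor_id] writes every vector as an m-part, an a-part and a combination of vectors
    e_(-al) of nonzero restricted weight. *)
Lemma weights_span (f : 'End(LC)) :
  (forall z, z \in cplx_sub m -> f z = 0) ->
  (forall z, z \in cplx_sub a -> f z = 0) ->
  (forall l z, restricted_roots l -> a_weight l z -> f z = 0) ->
  f = 0.
Proof.
move=> fm fa fl; apply/lfunP => z; rewrite zero_lfunE.
rewrite -[z](casimir_tensor_id htheta ha ht he hx hc) !tens_opD !linearD /=.
rewrite (fm _ (tens_op_varpi_m_mem hc z)) (fa _ (tens_op_sum_xx_mem hx z)) !add0r.
rewrite tens_op_root_tensor linear_sum big_seq big1 // => al.
move=> /(mem_nz htheta ha ht he)[ral al0].
have ral' := root_opp htheta ha ht ral.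
have ew := root_vec_a_weight htheta ha ht ral' (root_vec_e he ral').
rewrite linearZ /= (fl (restr (- al))) ?scaler0 //.
apply: a_weight_restricted_root ew; last by rewrite restrN oppr_eq0.
by case: (he ral') => _ _ [].
Qed.

Lemma tens_ext T T' :
  (forall z, z \in cplx_sub m -> tens_op T z = tens_op T' z) ->
  (forall z, z \in cplx_sub a -> tens_op T z = tens_op T' z) ->
  (forall l z, restricted_roots l -> a_weight l z -> tens_op T z = tens_op T' z) ->
  T = T'.
Proof.
move=> Em Ea El; apply: (tens_op_inj (cplx_killing_nondeg htheta)) => z.
pose f : 'End(LC) := linfun (tens_op T) - linfun (tens_op T').
have fE w : f w = tens_op T w - tens_op T' w by rewrite !lfun_simp ?lfunE.
apply/eqP; rewrite -subr_eq0 -fE.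
have -> : f = 0.
  apply: weights_span => [w wm|w wa|l w rl ww]; rewrite fE.
  - by rewrite Em // subrr.
  - by rewrite Ea // subrr.
  - by rewrite (El l) // subrr.
by rewrite zero_lfunE.
Qed.

(* With the convention of [tens_op], varpi_lambda is the projection onto the
   weight space of [- lambda]. *)

Lemma varpi_unique l T : restricted_roots l ->
  (forall z, a_weight (0 : dual a) z -> tens_op T z = 0) ->
  (forall l' z, restricted_roots l' -> l' + l != 0 -> a_weight l' z -> tens_op T z = 0) ->
  (forall z, a_weight (- l) z -> tens_op T z = z) ->
  T = varpi l.
Proof.
move=> rl T0 Tl T1; have [l0 _] := rl.
have z0 z : a_weight (0 : dual a) z -> tens_op (varpi l) z = 0.
  by apply: tens_op_varpi0; rewrite add0r.
apply: tens_ext => [z /a_weight_m zm|z /(a_weight_a ha) za|l' z rl' zw].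
- by rewrite T0 ?z0.
- by rewrite T0 ?z0.
have [|ll] := eqVneq (l' + l) 0; last by rewrite (Tl l') // (tens_op_varpi0 ll).
move/eqP; rewrite addr_eq0 => /eqP El; rewrite El in zw.
by rewrite T1 // tens_op_varpi_id.
Qed.

Lemma varpi_m_unique T :
  (forall z, z \in cplx_sub m -> tens_op T z = z) ->
  (forall z, z \in cplx_sub a -> tens_op T z = 0) ->
  (forall l z, restricted_roots l -> a_weight l z -> tens_op T z = 0) ->
  T = varpi_m c c'.
Proof.
move=> Tm Ta Tl; apply: tens_ext => [z zm|z za|l z rl zw].
- by rewrite Tm // (tens_op_varpi_m_id hc).
- rewrite Ta // (tens_op_varpi_m0 hc) // => w wm.
  by rewrite killingC (killing_m_a htheta ha).
- have [l0 _] := rl; rewrite (Tl l z rl zw) (tens_op_varpi_m0 hc) // => w wm.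
  exact: (killing_weight0_m l0 zw wm).
Qed.

Lemma sum_xx_unique T :
  (forall z, z \in cplx_sub m -> tens_op T z = 0) ->
  (forall z, z \in cplx_sub a -> tens_op T z = z) ->
  (forall l z, restricted_roots l -> a_weight l z -> tens_op T z = 0) ->
  T = sum_xx x.
Proof.
move=> Tm Ta Tl; apply: tens_ext => [z zm|z za|l z rl zw].
- rewrite Tm // (tens_op_sum_xx0 hx) // => w wa.
  by rewrite (killing_m_a htheta ha).
- by rewrite Ta // (tens_op_sum_xx_id ha hx).
- have [l0 _] := rl; rewrite (Tl l z rl zw) (tens_op_sum_xx0 hx) // => w wa.
  exact: (killing_weight0_a l0 zw wa).
Qed.

Local Notation sig := (fset_set Sigma).

Lemma mem_sig l : l \in sig -> restricted_roots l.
Proof.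
by rewrite in_fset_set; [move=> /set_mem|exact: (restricted_roots_finite htheta ha)].
Qed.

Lemma sig_mem l : restricted_roots l -> l \in sig.
Proof.
by rewrite in_fset_set; [move=> /mem_set|exact: (restricted_roots_finite htheta ha)].
Qed.

(** An injective self-map of a finite set permutes it. *)
Lemma sig_reindex (V : zmodType) (F : dual a -> V) (f : dual a -> dual a) :
  injective f -> (forall l, restricted_roots l -> restricted_roots (f l)) ->
  \sum_(l <- sig) F l = \sum_(l <- sig) F (f l).
Proof.
move=> fI fS; rewrite -[RHS](big_map f xpredT F); apply: perm_big.
have su : uniq [seq f l | l <- sig] by rewrite map_inj_uniq ?fset_uniq.
have sS : {subset [seq f l | l <- sig] <= sig}.
  by move=> _ /mapP[l /mem_sig ls ->]; apply/sig_mem/fS.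
rewrite perm_sym; apply: uniq_perm; rewrite ?fset_uniq //.
by case: (uniq_min_size su sS); rewrite ?size_map.
Qed.

Lemma sig_opp (V : zmodType) (F : dual a -> V) :
  \sum_(l <- sig) F l = \sum_(l <- sig) F (- l).
Proof.
apply: sig_reindex; [exact: oppr_inj|exact: (restricted_root_opp htheta ha)].
Qed.

(** Comparing operators avoids sorting the roots by their restriction: on weight [l] both root parts
    act as the identity, the right one through [varpi (- l)] alone. *)
Lemma casimir_tensor_varpi : casimir_tensor e x c c' =
  varpi_m c c' + sum_xx x + \sum_(l <- sig) varpi l.
Proof.
congr (_ + _); apply: tens_ext => [z zm|z za|l z rl zw].
- rewrite (tens_op_root_tensor0 htheta ha ht he (a_weight_m zm)).
  rewrite tens_op_sum big_seq big1 // => l' /mem_sig[l0 _].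
  by rewrite (tens_op_varpi0 _ (a_weight_m zm)) ?add0r.
- rewrite (tens_op_root_tensor0 htheta ha ht he (a_weight_a ha za)).
  rewrite tens_op_sum big_seq big1 // => l' /mem_sig[l0 _].
  by rewrite (tens_op_varpi0 _ (a_weight_a ha za)) ?add0r.
- have [l0 _] := rl; transitivity z.
    rewrite -[RHS](casimir_tensor_id htheta ha ht he hx hc) !tens_opD.
    rewrite (tens_op_varpi_m0 hc) => [|w wm]; last exact: (killing_weight0_m l0 zw wm).
    rewrite (tens_op_sum_xx0 hx) ?add0r // => w wa.
    exact: (killing_weight0_a l0 zw wa).
  rewrite tens_op_sum (bigD1_seq (- l)) ?fset_uniq //=; last first.
    exact/sig_mem/(restricted_root_opp htheta ha).
  rewrite tens_op_varpi_id ?oppr_eq0 ?opprK //.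
  rewrite big1 ?addr0 // => l' ll'.
  by rewrite (tens_op_varpi0 _ zw) // addrC addr_eq0.
Qed.

End Varpi.

(** * The tensors varpi_lambda *)

Section TensorMaps.
Variables (K : fieldType) (L : lieAlgType K).
Implicit Types (f g : 'End(L)) (T : tensor L).

Fact tens_map_linear f g : linear (tens_map f g).
Proof. by move=> k T T'; rewrite /tens_map mulmxDr mulmxDl -scalemxAr -scalemxAl. Qed.

HB.instance Definition _ f g := GRing.isLinear.Build K (tensor L) (tensor L) _
  (tens_map f g) (tens_map_linear f g).

Fact tens_swap_linear : linear (@tens_swap K L).
Proof. by move=> k T T'; rewrite /tens_swap linearP. Qed.

HB.instance Definition _ := GRing.isLinear.Build K (tensor L) (tensor L) _
  (@tens_swap K L) tens_swap_linear.

Lemma tens_map_comp f g f' g' T :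
  tens_map f g (tens_map f' g' T) = tens_map (f \o f')%VF (g \o g')%VF T.
Proof. by rewrite /tens_map !f2mx_comp trmx_mul !mulmxA. Qed.

Lemma tens_map_swap f g T : tens_swap (tens_map f g T) = tens_map g f (tens_swap T).
Proof. by rewrite /tens_map /tens_swap !trmx_mul trmxK mulmxA. Qed.

Lemma tens_swapK : involutive (@tens_swap K L).
Proof. by move=> T; rewrite /tens_swap trmxK. Qed.

Lemma tens_mapDl f f' g T :
  tens_map (f + f') g T = tens_map f g T + tens_map f' g T.
Proof. by rewrite /tens_map !linearD /= !mulmxDl. Qed.

Lemma tens_mapZl k f g T : tens_map (k *: f) g T = k *: tens_map f g T.
Proof. by rewrite /tens_map !linearZ /= -!scalemxAl. Qed.

Lemma tens_mapNl f g T : tens_map (- f) g T = - tens_map f g T.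
Proof. by rewrite -scaleN1r tens_mapZl scaleN1r. Qed.

Lemma tens_map1 T : tens_map \1%VF \1%VF T = T.
Proof.
rewrite /tens_map; have -> : f2mx (\1%VF : 'End(L)) = 1%:M.
  by apply/row_matrixP => i; rewrite !rowE -[delta_mx 0 i]r2vK -v2r_hom id_lfunE mulmx1.
by rewrite trmx1 mul1mx mulmx1.
Qed.

Lemma tensNl x z : tens (- x) z = - tens x z :> tensor L.
Proof. by rewrite /tens !linearN /= mulNmx. Qed.
Lemma tensNr x z : tens x (- z) = - tens x z :> tensor L.
Proof. by rewrite /tens linearN mulmxN. Qed.

Variables (U : algType K) (i : {linear L -> U}).

Fact mult_map_linear : linear (mult_map i).
Proof.
move=> k T T'; rewrite /mult_map scaler_sumr -big_split; apply: eq_bigr => j _.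
rewrite scaler_sumr -big_split; apply: eq_bigr => l _.
by rewrite !mxE scalerDl scalerA.
Qed.

HB.instance Definition _ := GRing.isLinear.Build K (tensor L) U _
  (mult_map i) mult_map_linear.

End TensorMaps.

Section VarpiIdentities.
Variables (R : realType) (L : lieAlgType R) (theta : 'End(L)).
Hypothesis htheta : cartan_involution theta.
Variables (a t : {vspace L}).
Hypothesis ha : maximal_abelian_in a (p_space theta).
Hypothesis ht : maximal_abelian_in t (m_space theta a).
Local Notation LC := (cplx L).
Local Notation C := R[i].
Local Notation H := (cartan a t).
Local Notation m := (m_space theta a).
Local Notation thetaC := (cplx_end theta).
Variables h e : dual H -> LC.
Hypothesis he : root_vectors h e.
Variables (r : nat) (x : r.-tuple L).
Hypothesis hx : orthonormal_basis theta a x.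
Variables (d : nat) (c c' : d.-tuple LC).
Hypothesis hc : dual_bases (cplx_sub m) c c'.
Implicit Types (z w k : LC) (al be : dual H) (l : dual a) (T : tensor LC).
Local Notation varpi := (varpi (t := t) e).
Local Notation Sigma := (@restricted_roots R L a).
Local Notation sig := (fset_set Sigma).

(** Here the root vectors only trade places, so the sum can be reindexed by the bijection al to -al
    between the roots over [l] and those over [- l]. *)
Lemma varpi_swap l : tens_swap (varpi l) = varpi (- l).
Proof.
rewrite !(varpiE htheta ha ht he) linear_sum /=.
under eq_bigr => al _ do rewrite tens_swapE.
have -> : \sum_(al <- fset_set (@roots_over R L a t l)) tens (e al) (e (- al)) =
    \sum_(al <- [seq - al | al <- fset_set (@roots_over R L a t l)]) tens (e (- al)) (e al).
  by rewrite big_map; apply: eq_bigr => al _; rewrite opprK.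
apply: perm_big; apply: uniq_perm.
- by rewrite (map_inj_uniq oppr_inj) fset_uniq.
- exact: fset_uniq.
have E l' al : al \in fset_set (@roots_over R L a t l') ->
    - al \in fset_set (@roots_over R L a t (- l')).
  move=> /(mem_roots_over htheta ha ht he)[ral E].
  rewrite in_fset_set; last exact: (finite_roots_over htheta ha ht he).
  apply/mem_set/(roots_overP htheta ha ht); rewrite restrN E; split=> //.
  exact: (root_opp htheta ha ht).
move=> al; apply/mapP/idP => [[be bl ->]|all]; first exact: E.
by exists (- al); rewrite ?opprK // -[l]opprK E.
Qed.

(** On operators theta (x) theta is conjugation by theta, which turns the projection onto the weight
    space of -l into the one for l. *)
Lemma varpi_theta l : restricted_roots l -> tens_map thetaC thetaC (varpi l) = varpi (- l).
Proof.
move=> rl; have [l0 _] := rl.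
have opE z : tens_op (tens_map thetaC thetaC (varpi l)) z =
    thetaC (tens_op (varpi l) (thetaC z)).
  by apply: tens_op_map; exact: (killing_cplx_theta htheta).
apply: (varpi_unique htheta ha ht he hx hc).
- exact: (restricted_root_opp htheta ha).
- move=> z /(a_weight_theta htheta ha); rewrite oppr0 opE => zw.
  by rewrite (tens_op_varpi0 htheta ha ht he _ zw) ?linear0 ?add0r.
- move=> l' z _ ll /(a_weight_theta htheta ha) zw; rewrite opE.
  rewrite (tens_op_varpi0 htheta ha ht he _ zw) ?linear0 //.
  by rewrite -oppr_eq0 opprD opprK.
- move=> z /(a_weight_theta htheta ha); rewrite opprK opE => zw.
  by rewrite (tens_op_varpi_id htheta ha ht he hx hc) // (cplx_thetaK htheta).
Qed.

Lemma theta_m z : z \in cplx_sub m -> thetaC z = z.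
Proof.
rewrite mem_cplx_sub => /andP[/mem_m_space[z1 _] /mem_m_space[z2 _]].
by case: z z1 z2 => u v; rewrite cplx_endE /= => -> ->.
Qed.

Lemma theta_cplx_a z : z \in cplx_sub a -> thetaC z = - z.
Proof.
rewrite mem_cplx_sub => /andP[/(theta_a ha) z1 /(theta_a ha) z2].
by case: z z1 z2 => u v; rewrite cplx_endE /= => -> ->.
Qed.

Lemma varpi_m_swap : tens_swap (varpi_m c c') = varpi_m c c'.
Proof.
rewrite linear_sum /=; under eq_bigr => s _ do rewrite tens_swapE.
have hc' := dual_basesC hc; rewrite -/(varpi_m c' c).
apply: (varpi_m_unique htheta ha ht he hx hc) => [z zm|z za|l z [l0 _] zw].
- exact: (tens_op_varpi_m_id hc').
- rewrite (tens_op_varpi_m0 hc') // => w wm.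
  by rewrite killingC (killing_m_a htheta ha).
- rewrite (tens_op_varpi_m0 hc') // => w wm.
  exact: (killing_weight0_m l0 zw wm).
Qed.

Lemma sum_xx_swap : tens_swap (sum_xx x) = sum_xx x.
Proof. by rewrite linear_sum; apply: eq_bigr => s _; rewrite /= tens_swapE. Qed.

Lemma varpi_m_theta : (tens_map \1%VF thetaC (varpi_m c c') = varpi_m c c') *
  (tens_map thetaC \1%VF (varpi_m c c') = varpi_m c c').
Proof.
case: hc => cB cB' _; split; rewrite linear_sum; apply: eq_bigr => s _;
  by rewrite /= tens_mapE id_lfunE theta_m // basis_tnth_mem.
Qed.

Lemma sum_xx_theta : (tens_map \1%VF thetaC (sum_xx x) = - sum_xx x) *
  (tens_map thetaC \1%VF (sum_xx x) = - sum_xx x).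
Proof.
by split; rewrite linear_sum -sumrN; apply: eq_bigr => s _;
  rewrite /= tens_mapE id_lfunE theta_cplx_a ?tensNr ?tensNl // mem_cplx_of (mem_x hx).
Qed.

(** The exchanged tensor equals its image under theta (x) theta, and the second theta cancels. This
    is the source of the symmetry (id (x) theta) r_21 = (theta (x) id) r. *)
Lemma varpi_swap_theta l : restricted_roots l ->
  tens_map \1%VF thetaC (tens_swap (varpi l)) = tens_map thetaC \1%VF (varpi l).
Proof.
move=> rl; rewrite varpi_swap -varpi_theta // tens_map_comp comp_lfun1l.
congr (tens_map _ _ _); apply/lfunP => z.
by rewrite comp_lfunE id_lfunE (cplx_thetaK htheta).
Qed.

Definition coroot_sum l : LC := \sum_(al <- fset_set (@roots_over R L a t l)) h al.

(** By [varpi_swap] the difference is a sum of commutators of e_al with e_(-al), which drops the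
    degree from two to one. *)
Lemma mult_map_varpi (U : algType C) (iU : {linear LC -> U}) l : lie_to_alg iU ->
  mult_map iU (varpi (- l)) - mult_map iU (varpi l) = iU (coroot_sum l).
Proof.
move=> iL; rewrite -varpi_swap (varpiE htheta ha ht he) [tens_swap _]linear_sum.
rewrite !(linear_sum (mult_map iU)) [RHS](linear_sum iU) /= -sumrB.
apply: eq_big_seq => al /(mem_roots_over htheta ha ht he)[ral _].
by rewrite tens_swapE !mult_mapE -iL; case: (he ral) => _ _ _ ->.
Qed.

(** The bracket as a linear map on tensors, through which identities between the tensors [varpi l]
    pass to the sums of the [h al]. *)
Definition lie_map T : LC := \sum_j \sum_k T j k *: lie (coord_vec j) (coord_vec k).

Fact lie_map_linear : linear lie_map.
Proof.
move=> k T T'; rewrite /lie_map scaler_sumr -big_split; apply: eq_bigr => j _.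
rewrite scaler_sumr -big_split; apply: eq_bigr => l _.
by rewrite !mxE scalerDl scalerA.
Qed.

HB.instance Definition _ := GRing.isLinear.Build C (tensor LC) LC _ lie_map lie_map_linear.

Lemma lie_mapE y z : lie_map (tens y z) = lie y z.
Proof.
rewrite {2}[y]vec_coord {2}[z]vec_coord.
rewrite (big_morph (lie^~ _) (fun u v => lieDl u v _) (lie0l _)).
apply: eq_bigr => j _; rewrite linear_sum; apply: eq_bigr => k _.
by rewrite /= lieZl lieZr scalerA /tens mxE big_ord1 mxE.
Qed.

Lemma coroot_sumE l : coroot_sum l = - lie_map (varpi l).
Proof.
rewrite (varpiE htheta ha ht he) (linear_sum lie_map) -sumrN; apply: eq_big_seq => al.
move=> /(mem_roots_over htheta ha ht he)[ral _].
by rewrite /= lie_mapE -lieC; case: (he ral) => _ _ _ ->.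
Qed.

(* The t-component of the sum of the [h al] vanishes: exchanging the components
   of varpi_lambda and applying theta (x) theta to it both give
   varpi_(- lambda). *)

Lemma theta_coroot_sum l : restricted_roots l -> thetaC (coroot_sum l) = - coroot_sum l.
Proof.
have thetaL : lie_endo thetaC by apply: cplx_end_lie; case: htheta.
move=> rl; have E : lie_map (tens_swap (varpi l)) = - lie_map (varpi l).
  rewrite (varpiE htheta ha ht he) [tens_swap _]linear_sum.
  rewrite !(linear_sum lie_map) -sumrN; apply: eq_bigr => al _.
  by rewrite /= tens_swapE !lie_mapE lieC.
rewrite coroot_sumE linearN -E varpi_swap -varpi_theta //; congr (- _).
rewrite (varpiE htheta ha ht he) [tens_map _ _ _]linear_sum.
rewrite !(linear_sum lie_map) linear_sum; apply: eq_bigr => al _.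
by rewrite /= tens_mapE !lie_mapE thetaL.
Qed.

(** The sum lies in H, hence in m + a. As theta negates it but fixes its m-part, that part is 0. *)
Lemma coroot_sum_a l : restricted_roots l -> coroot_sum l \in cplx_sub a.
Proof.
move=> rl; have sH : coroot_sum l \in H.
  rewrite /coroot_sum big_seq; apply: memv_suml => al.
  by move=> /(mem_roots_over htheta ha ht he)[ral _]; case: (he ral).
have : coroot_sum l \in (cplx_sub m + cplx_sub a)%VS.
  apply: (a_weight0 htheta ha) => y ya.
  by rewrite (cartan_abelian ha ht) ?cplx_of_a_cartan // zero_lfunE scale0r.
move=> /memv_addP[u um [v va E]]; have := theta_coroot_sum rl.
rewrite E linearD /= theta_m // theta_cplx_a // opprD => /addIr/eqP.
rewrite -addr_eq0 -mulr2n -scaler_nat scaler_eq0 pnatr_eq0 /= => /eqP ->.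
by rewrite add0r.
Qed.

(** Both sides lie in a and are compared by pairing with a, where each of the mtp(l) roots over [l]
    takes the value of [l]. *)
Lemma coroot_sum_mtp (tl : dual a -> LC) l : coroot_vectors tl -> restricted_roots l ->
  coroot_sum l = (mtp t l)%:R *: tl l.
Proof.
move=> htl rl; have [tla tlE] := htl l rl.
apply/eqP; rewrite -subr_eq0; apply/eqP/(cpt_herm_eq0 htheta).
set s := _ - _; have sa : s \in cplx_sub a.
  by rewrite memvB ?memvZ // coroot_sum_a.
(* The space a is stable under [tau], so orthogonality to a includes orthogonality of [s] to its own
   conjugate. *)
suff F z : z \in cplx_sub a -> killing s z = 0.
  apply: F; move: sa; rewrite !mem_cplx_sub /cpt_conj /= => /andP[s1 s2].
  by rewrite !(theta_a ha) // !memvN s1 s2.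
suff {z} F y : y \in a -> killing s (cplx_of y) = 0.
  rewrite mem_cplx_sub => /andP[z1 z2].
  by rewrite [z]cplxE killingDr killingZr !F // mulr0 addr0.
move=> ya; rewrite killingDl killingNl killingZl.
have -> : killing (tl l) (cplx_of y) = (l (vsproj a y) : R)%:C.
  have := tlE (vsproj a y) 0; by rewrite vsprojK // !linear0.
rewrite /coroot_sum killing_suml.
under eq_big_seq => al /(mem_roots_over htheta ha ht he)[ral E].
  rewrite killingC (root_coroot he ral) ?cplx_of_a_cartan //.
  rewrite (root_restr htheta ha ht ral ya) E; over.
rewrite big_const_seq count_predT iter_addr_0 -[size _]/(mtp t l).
by rewrite mulr_natl subrr.
Qed.

End VarpiIdentities.

(** * The formulas for r+, r- and kappa *)

Section Xi.
Variables (R : realType) (L : lieAlgType R) (G : topGroupType) (ex : L -> G).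
Variable (a : {vspace L}).
Implicit Types (l : dual a) (g : G).

Lemma xiD l l' g : xi ex (l + l') g = xi ex l g * xi ex l' g.
Proof. by rewrite /xi add_lfunE expRD rmorphM. Qed.

Lemma xiN l g : xi ex (- l) g = (xi ex l g)^-1.
Proof. by rewrite /xi opp_lfunE expRN fmorphV. Qed.

Lemma xi_neq0 l g : xi ex l g != 0.
Proof. by rewrite /xi fmorph_eq0 gt_eqF // expR_gt0. Qed.

Lemma xi_gt0 l g : 0 < xi ex l g.
Proof. by rewrite /xi ltcR expR_gt0. Qed.

(** Regularity only excludes the value 1 of xi_l; positivity excludes -1, so the denominators 1 -
    xi_(2l) do not vanish. *)
Lemma xi_double_neq1 l g : xi ex l g != 1 -> xi ex (l *+ 2) g != 1.
Proof.
move=> l1; rewrite mulr2n xiD -expr2 sqrf_eq1 negb_or l1 /=.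
by rewrite gt_eqF // (lt_trans _ (xi_gt0 l g)) // ltrN10.
Qed.

Lemma A_reg_xi g l : A_reg ex a g -> restricted_roots l -> xi ex (l *+ 2) g != 1.
Proof. by move=> [_ gP] /gP; exact: xi_double_neq1. Qed.

End Xi.

Lemma split_half (K : numFieldType) (V : lmodType K) (v : V) :
  v = 2^-1 *: v + 2^-1 *: v.
Proof.
have E : 2^-1 + 2^-1 = 1 :> K by rewrite [RHS]splitr mul1r.
by rewrite -scalerDl E scale1r.
Qed.

Section Formulas.
Variables (R : realType) (L : lieAlgType R) (G : topGroupType) (ex : L -> G).
Variables (theta : 'End(L)).
Hypothesis htheta : cartan_involution theta.
Variables (a t : {vspace L}).
Hypothesis ha : maximal_abelian_in a (p_space theta).
Hypothesis ht : maximal_abelian_in t (m_space theta a).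
Local Notation LC := (cplx L).
Local Notation C := R[i].
Local Notation H := (cartan a t).
Local Notation m := (m_space theta a).
Local Notation thetaC := (cplx_end theta).
Variables h e : dual H -> LC.
Hypothesis he : root_vectors h e.
Variables (r : nat) (x : r.-tuple L).
Hypothesis hx : orthonormal_basis theta a x.
Variables (d : nat) (c c' : d.-tuple LC).
Hypothesis hc : dual_bases (cplx_sub m) c c'.
Implicit Types (z w k : LC) (al be : dual H) (l : dual a) (T : tensor LC) (g : G).
Local Notation varpi := (varpi (t := t) e).
Local Notation Sigma := (@restricted_roots R L a).
Local Notation sig := (fset_set Sigma).
Local Notation rr := (r_mx ex e x c c').

Local Notation q l g := ((1 - xi ex (- (l *+ 2)) g)^-1).

Lemma fsum_sig (V : zmodType) (F : dual a -> V) :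
  \sum_(l \in Sigma) F l = \sum_(l <- sig) F l.
Proof. by rewrite fsbig_finite //; exact: (restricted_roots_finite htheta ha). Qed.

Lemma r_mxE g : rr g = - (2^-1 *: varpi_m c c') - 2^-1 *: sum_xx x
  - \sum_(l <- sig) q l g *: varpi l.
Proof. by rewrite /r_mx fsum_sig. Qed.

Lemma theta_r_mx g : tens_map thetaC \1%VF (rr g) =
  - (2^-1 *: varpi_m c c') + 2^-1 *: sum_xx x
  - \sum_(l <- sig) q l g *: tens_map thetaC \1%VF (varpi l).
Proof.
rewrite r_mxE !linearB linearN !linearZ /=.
rewrite (varpi_m_theta hc) (sum_xx_theta ha hx) scalerN opprK; congr (_ - _).
by rewrite linear_sum; apply: eq_bigr => l _; rewrite linearZ.
Qed.

Lemma r_mx_swap g : tens_swap (rr g) = - (2^-1 *: varpi_m c c')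
  - 2^-1 *: sum_xx x - \sum_(l <- sig) q l g *: varpi (- l).
Proof.
rewrite r_mxE !(linearB (@tens_swap _ LC)) (linearN (@tens_swap _ LC)).
rewrite (linear_sum (@tens_swap _ LC)) !linearZ /=.
rewrite (varpi_m_swap htheta ha ht he hx hc) sum_xx_swap; congr (_ - _).
by apply: eq_bigr => l _; rewrite linearZ /= (varpi_swap htheta ha ht he).
Qed.

Lemma theta_r_mx_swap g : tens_map \1%VF thetaC (tens_swap (rr g)) =
  tens_map thetaC \1%VF (rr g).
Proof.
rewrite theta_r_mx r_mx_swap !linearB linearN !linearZ /=.
rewrite (varpi_m_theta hc) (sum_xx_theta ha hx) scalerN opprK; congr (_ - _).
rewrite linear_sum big_seq [RHS]big_seq; apply: eq_bigr => l /(mem_sig htheta ha) rl.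
by rewrite linearZ /= -(varpi_swap htheta ha ht he) (varpi_swap_theta htheta ha ht he hx hc).
Qed.

(** As theta fixes m and negates a, the halves of [varpi_m] add up and those of [sum_xx] cancel; for
    r^- it is the other way round. *)
Lemma r_plusE g : r_plus ex theta e c c' g =
  rr g + tens_map \1%VF thetaC (tens_swap (rr g)).
Proof.
rewrite theta_r_mx_swap theta_r_mx r_mxE /r_plus fsum_sig.
set A := varpi_m _ _; set X := sum_xx _.
rewrite addrACA; congr (_ + _).
  by rewrite {1}[A]split_half addrACA addNr addr0 -opprD.
rewrite -opprD -big_split /=; congr (- _).
apply: eq_bigr => l _; rewrite -scalerDr /pr_k tens_mapZl tens_mapDl tens_map1.
by rewrite scalerA mulrAC divff ?pnatr_eq0 // mul1r.
Qed.

Lemma r_minusE g : r_minus ex theta e x g =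
  - rr g + tens_map \1%VF thetaC (tens_swap (rr g)).
Proof.
rewrite theta_r_mx_swap theta_r_mx r_mxE /r_minus fsum_sig.
set A := varpi_m _ _; set X := sum_xx _.
rewrite !opprD !opprK addrACA; congr (_ + _).
  by rewrite {1}[X]split_half addrACA subrr add0r.
rewrite -sumrB; apply: eq_bigr => l _; rewrite -scalerBr /pr_p
  tens_mapZl tens_mapDl tens_mapNl tens_map1.
by rewrite scalerA mulrAC divff ?pnatr_eq0 // mul1r.
Qed.

Variables (n : nat) (b b' : n.-tuple LC) (hb : dual_bases fullv b b').
Variables (U : algType C) (iU : {linear LC -> U}).
Hypothesis iL : lie_to_alg iU.
Variables (tl : dual a -> LC).
Hypothesis htl : coroot_vectors tl.

(** The tensor of any pair of dual bases of g acts as the identity, as does [casimir_tensor], so the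
    two coincide. *)
Lemma casimir_varpi : casimir b b' iU = mult_map iU (varpi_m c c') +
  mult_map iU (sum_xx x) + \sum_(l <- sig) mult_map iU (varpi l).
Proof.
have E : \sum_s tens (tnth b s) (tnth b' s) = casimir_tensor e x c c' :> tensor LC.
  apply: (tens_op_inj (cplx_killing_nondeg htheta)) => z.
  rewrite (casimir_tensor_id htheta ha ht he hx hc) tens_op_sum.
  under eq_bigr do rewrite tens_op_tens.
  by rewrite (dual_bases_sum hb) ?memvf.
rewrite -(linear_sum (mult_map iU)) -!(linearD (mult_map iU)) /=.
rewrite -(casimir_tensor_varpi htheta ha ht he hx hc) -E linear_sum.
by apply: eq_bigr => s _; rewrite /= mult_mapE.
Qed.

Lemma kappa_coreE g : A_reg ex a g -> kappa_core ex theta e c c' b b' iU g =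
  mult_map iU (tens_map \1%VF thetaC (tens_swap (rr g))) +
  4^-1 *: \sum_(l \in Sigma)
    ((1 + xi ex (l *+ 2) g) / (1 - xi ex (l *+ 2) g) * (mtp t l)%:R) *: iU (tl l).
Proof.
move=> gA; rewrite /kappa_core r_plusE fsum_sig [tens_swap (_ + _)]linearD /=.
rewrite tens_map_swap tens_swapK -theta_r_mx_swap linearD /=.
rewrite addrA addrC; congr (_ + _).
rewrite casimir_varpi r_mx_swap.
rewrite !(linearB (mult_map iU)) (linearN (mult_map iU)) /=.
rewrite [mult_map iU (\sum_(l <- sig) _)](linear_sum (mult_map iU)).
under [X in _ + (_ - X)]eq_bigr do rewrite /= linearZ.
rewrite !linearZ /=.
pose M l := mult_map iU (varpi l).
(* The 1/2 comes from the Casimir element, the inverse from r_21 after replacing l by -l. With X =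
   xi_(2l) this is -(1 + X)/(2(1 - X)), which changes sign under inversion of X. *)
pose f l : C := 2^-1 - (1 - xi ex (l *+ 2) g)^-1.
have f_odd l : l \in sig -> f (- l) = - f l.
  move=> /(mem_sig htheta ha) rl; have X1 := A_reg_xi gA rl.
  rewrite /f mulNrn xiN; move: (xi _ _ _) (xi_neq0 ex (l *+ 2) g) X1 => X X0 X1.
  by field; rewrite X0 !subr_eq0 X1 eq_sym X1.
transitivity (\sum_(l <- sig) f l *: M l).
  have -> : \sum_(l <- sig) q l g *: M (- l) =
      \sum_(l <- sig) (1 - xi ex (l *+ 2) g)^-1 *: M l.
    by rewrite (sig_opp htheta ha); apply: eq_bigr => l _; rewrite mulNrn !opprK.
  rewrite !scalerDr !scalerN addrACA -opprD subrr add0r scaler_sumr -sumrB.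
  by apply: eq_bigr => l _; rewrite scalerBl.
(* Half of the sum is reindexed by -l, using that [f] is odd; -f/2 is (1 + X)/(4(1 - X)). *)
transitivity (\sum_(l <- sig) (- (2^-1 * f l)) *: (M (- l) - M l)); last first.
  rewrite scaler_sumr big_seq [RHS]big_seq; apply: eq_bigr => l /(mem_sig htheta ha) rl.
  rewrite /M (mult_map_varpi htheta ha ht he l iL).
  rewrite (coroot_sum_mtp htheta ha ht he hx hc htl rl) linearZ /= !scalerA.
  congr (_ *: _); rewrite mulrA; congr (_ * _).
  have X1 := A_reg_xi gA rl; rewrite /f; move: (xi _ _ _) X1 => X X1.
  by field; rewrite subr_eq0 eq_sym X1 ?pnatr_eq0.
under [RHS]eq_bigr do rewrite scalerBr.
rewrite sumrB [X in _ = X - _](sig_opp htheta ha) -sumrB big_seq [RHS]big_seq.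
apply: eq_bigr => l ls; rewrite opprK f_odd // -scalerBl; congr (_ *: _).
by field; rewrite ?pnatr_eq0.
Qed.

End Formulas.

(** * Automorphisms *)

Section Pullback.
Variables (K : fieldType) (L : lieAlgType K) (a : {vspace L}).
Implicit Types (f g : 'End(L)) (l : dual a).

(** The functional l o g on a; because of the projection [vsproj] it has this meaning only when [g]
    preserves a. *)
Definition dual_pull g l : dual a := (l \o linfun (vsproj a) \o g \o linfun vsval)%VF.

Lemma dual_pullE g l y : y \in a ->
  dual_pull g l (vsproj a y) = l (vsproj a (g y)).
Proof. by move=> ya; rewrite !comp_lfunE !lfunE /= vsprojK. Qed.

Lemma dual_ext l l' : (forall y, y \in a -> l (vsproj a y) = l' (vsproj a y)) -> l = l'.
Proof.
by move=> E; apply/lfunP => y; have := E _ (subvsP y); rewrite vsvalK.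
Qed.

Lemma dual_pullK f g : cancel g f -> (forall y, y \in a -> g y \in a) ->
  cancel (dual_pull f) (dual_pull g).
Proof.
by move=> gK ga l; apply: dual_ext => y ya; rewrite !dual_pullE ?ga // gK.
Qed.

Lemma dual_pullD g l l' : dual_pull g (l + l') = dual_pull g l + dual_pull g l'.
Proof. by rewrite /dual_pull !comp_lfunDl. Qed.

Lemma dual_pullN g l : dual_pull g (- l) = - dual_pull g l.
Proof. by rewrite /dual_pull !comp_lfunNl. Qed.

Lemma dual_pull0 g : dual_pull g 0 = 0.
Proof. by rewrite /dual_pull !comp_lfun0l. Qed.

End Pullback.

Section Automorphisms.
Variables (R : realType) (L : lieAlgType R) (theta : 'End(L)).
Hypothesis htheta : cartan_involution theta.
Variables (a t : {vspace L}).
Hypothesis ha : maximal_abelian_in a (p_space theta).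
Hypothesis ht : maximal_abelian_in t (m_space theta a).
Local Notation LC := (cplx L).
Local Notation C := R[i].
Local Notation H := (cartan a t).
Local Notation m := (m_space theta a).
Local Notation thetaC := (cplx_end theta).
Variables h e : dual H -> LC.
Hypothesis he : root_vectors h e.
Variables (r : nat) (x : r.-tuple L).
Hypothesis hx : orthonormal_basis theta a x.
Variables (d : nat) (c c' : d.-tuple LC).
Hypothesis hc : dual_bases (cplx_sub m) c c'.
Implicit Types (z w k : LC) (al be : dual H) (l : dual a) (T : tensor LC).
Local Notation varpi := (varpi (t := t) e).

Lemma cplx_endK (f g : 'End(L)) : cancel f g -> cancel (cplx_end f) (cplx_end g).
Proof. by move=> fK z; rewrite !cplx_endE /= !fK; case: z. Qed.

(** [y, f z] = f [g y, z], so weights are pulled back along the inverse. *)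
Lemma a_weight_aut (f g : 'End(L)) l z : lie_endo f -> cancel g f ->
  (forall y, y \in a -> g y \in a) -> a_weight l z ->
  a_weight (dual_pull g l) (cplx_end f z).
Proof.
move=> fL gK ga zw y ya.
have -> : cplx_of y = cplx_end f (cplx_of (g y)).
  by rewrite cplx_endE /= gK linear0.
by rewrite -(cplx_end_lie fL) zw ?ga // linearZ /= dual_pullE.
Qed.

Lemma restricted_root_aut (f g : 'End(L)) l : lie_endo f -> cancel f g -> cancel g f ->
  (forall y, y \in a -> f y \in a) -> (forall y, y \in a -> g y \in a) ->
  restricted_roots l -> restricted_roots (dual_pull g l).
Proof.
move=> fL fK gK fa ga rl; have [l0 _] := rl.
have [y y0 yw] := restricted_root_weight rl.
apply: (a_weight_restricted_root _ _ (a_weight_aut fL gK ga yw)).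
  apply: contra y0 => /eqP/(congr1 (cplx_end g)).
  by rewrite (cplx_endK fK) linear0 => -[->].
apply: contra l0 => /eqP/(congr1 (dual_pull f)).
by rewrite (dual_pullK fK fa) dual_pull0 => ->.
Qed.

Section OneAut.
Variables (f g : 'End(L)).
Hypotheses (fL : lie_endo f) (gL : lie_endo g).
Hypotheses (fK : cancel f g) (gK : cancel g f).
Hypotheses (fa : forall y, y \in a -> f y \in a) (ga : forall y, y \in a -> g y \in a).
Hypothesis gtheta : forall y, theta (g y) = g (theta y).

(** An automorphism preserves the Killing form, so its adjoint is its inverse and f (x) f conjugates
    operators. *)
Let tens_op_aut T z : tens_op (tens_map (cplx_end f) (cplx_end f) T) z =
  cplx_end f (tens_op T (cplx_end g z)).
Proof.
apply: tens_op_map => y w; rewrite -{1}[w](cplx_endK gK).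
exact: (killing_aut (cplx_end_lie fL) (cplx_endK fK) (cplx_endK gK)).
Qed.

Let aut_cplx_a z : z \in cplx_sub a -> cplx_end g z \in cplx_sub a.
Proof. by rewrite !mem_cplx_sub cplx_endE => /andP[/ga -> /ga ->]. Qed.

Let aut_cplx_m z : z \in cplx_sub m -> cplx_end g z \in cplx_sub m.
Proof.
have E u : u \in m -> g u \in m.
  move=> /mem_m_space[u1 u2]; apply/mem_m_space; split; first by rewrite gtheta u1.
  by move=> y ya; rewrite -[y]fK -gL u2 ?fa // linear0.
by rewrite !mem_cplx_sub cplx_endE => /andP[/E -> /E ->].
Qed.

Let pull_neq0 l : l != 0 -> dual_pull f l != 0.
Proof.
apply: contra => /eqP/(congr1 (dual_pull g)).
by rewrite (dual_pullK gK ga) dual_pull0 => ->.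
Qed.

Lemma varpi_aut l : restricted_roots l ->
  tens_map (cplx_end f) (cplx_end f) (varpi l) = varpi (dual_pull g l).
Proof.
move=> rl; have [l0 _] := rl; apply: (varpi_unique htheta ha ht he hx hc).
- exact: restricted_root_aut rl.
- move=> z /(a_weight_aut gL fK fa); rewrite dual_pull0 tens_op_aut => zw.
  by rewrite (tens_op_varpi0 htheta ha ht he _ zw) ?linear0 ?add0r.
- move=> l' z _ ll /(a_weight_aut gL fK fa) zw; rewrite tens_op_aut.
  rewrite (tens_op_varpi0 htheta ha ht he _ zw) ?linear0 //.
  apply: contra ll => /eqP/(congr1 (dual_pull g)).
  by rewrite dual_pullD (dual_pullK gK ga) dual_pull0 => ->.
- move=> z /(a_weight_aut gL fK fa); rewrite dual_pullN (dual_pullK fK fa) tens_op_aut.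
  by move=> zw; rewrite (tens_op_varpi_id htheta ha ht he hx hc) // (cplx_endK gK).
Qed.

Lemma varpi_m_aut :
  tens_map (cplx_end f) (cplx_end f) (varpi_m c c') = varpi_m c c'.
Proof.
apply: (varpi_m_unique htheta ha ht he hx hc) => [z zm|z za|l z [l0 _] zw];
  rewrite tens_op_aut.
- by rewrite (tens_op_varpi_m_id hc) ?aut_cplx_m // (cplx_endK gK).
- rewrite (tens_op_varpi_m0 hc) ?linear0 // => w wm.
  by rewrite killingC (killing_m_a htheta ha) ?aut_cplx_a.
- rewrite (tens_op_varpi_m0 hc) ?linear0 // => w wm.
  exact: (killing_weight0_m (pull_neq0 l0) (a_weight_aut gL fK fa zw) wm).
Qed.

Lemma sum_xx_aut : tens_map (cplx_end f) (cplx_end f) (sum_xx x) = sum_xx x.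
Proof.
apply: (sum_xx_unique htheta ha ht he hx hc) => [z zm|z za|l z [l0 _] zw];
  rewrite tens_op_aut.
- rewrite (tens_op_sum_xx0 hx) ?linear0 // => w wa.
  by rewrite (killing_m_a htheta ha) ?aut_cplx_m.
- by rewrite (tens_op_sum_xx_id ha hx) ?aut_cplx_a // (cplx_endK gK).
- rewrite (tens_op_sum_xx0 hx) ?linear0 // => w wa.
  exact: (killing_weight0_a ha (pull_neq0 l0) (a_weight_aut gL fK fa zw) wa).
Qed.

End OneAut.
End Automorphisms.

(** * The Lie group *)

(** Convergence at s = 1 bounds the coefficients by some M, and s = 0 gives d = c_0. The terms
    beyond the linear one are then O(s^2), too small to cancel a nonzero linear term. *)
Lemma pseries_const_coef1 (R : realType) (c : nat -> R) (d : R) :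
  (forall s : R, (fun n : nat => \sum_(k < n) s ^+ k * c k) @ \oo --> d) ->
  c 1%N = 0.
Proof.
move=> cd.
have [M M0 cM] : exists2 M : R, 0 < M & forall k, `|c k| <= M.
  have : cvgn (series c).
    apply/cvg_ex; exists d; rewrite (_ : series c = fun n => \sum_(k < n) 1 ^+ k * c k) //.
    apply/funext => n; rewrite /series /= big_mkord.
    by apply: eq_bigr => k _; rewrite expr1n mul1r.
  move=> /cvg_series_bounded[K [_ Kc]]; exists (`|K| + 1).
    by rewrite ltr_wpDl.
  by move=> k; apply: Kc => //; rewrite (le_lt_trans (ler_norm K)) // ltrDl.
have c0 : d = c 0%N.
  apply: (@cvg_unique _ (@Rhausdorff R) ((fun n : nat => \sum_(k < n) 0 ^+ k * c k) @ \oo)).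
    exact: cd.
  apply: cvg_near_cst; exists 1%N => // -[//|n _].
  rewrite big_ord_recl expr0 mul1r big1 ?addr0 // => i _.
  by rewrite expr0n mul0r.
have est (s : R) : 0 <= s -> s <= 2^-1 -> s * `|c 1%N| <= 2 * M * s ^+ 2.
  move=> s0 s1.
  (* The additional summand bounds the rest of the geometric series for s at most 1/2 and carries
     the induction. *)
  have geo n : \sum_(k < n) s ^+ k.+2 * M + 2 * M * s ^+ n.+2 <= 2 * M * s ^+ 2.
    elim: n => [|n IH]; first by rewrite big_ord0 add0r.
    apply: le_trans IH; rewrite big_ord_recr /= -addrA lerD2l [s ^+ n.+3]exprS.
    have : 0 <= s ^+ n.+2 * M by rewrite mulr_ge0 ?exprn_ge0 // ltW.
    set w := s ^+ _ => wM.
    have : 0 <= (1 - 2 * s) * (w * M) by rewrite mulr_ge0 //; lra.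
    lra.
  have lim := cvg_norm (cvgB (cd s) (@cvg_cst _ (c 0%N + s * c 1%N) nat \oo _)).
  have -> : s * `|c 1%N| = `|d - (c 0%N + s * c 1%N)|.
    by rewrite c0 opprD addrA subrr sub0r normrN normrM ger0_norm.
  apply: (cvgr_to_le (lim _ _ _)); exists 2%N => // -[//|[//|n]] _ /=.
  rewrite -[leLHS]/(`|\sum_(k < n.+2) s ^+ k * c k - (c 0%N + s * c 1%N)|).
  rewrite 2!big_ord_recl /= expr0 mul1r expr1 opprD addrACA subrr add0r.
  rewrite addrAC subrr add0r (le_trans (ler_norm_sum _ _ _)) //.
  apply: le_trans (geo n); rewrite -[leLHS]addr0 lerD //; last first.
    by rewrite mulr_ge0 ?exprn_ge0 // mulr_ge0 // ltW.
  apply: ler_sum => i _; rewrite /bump /= !add1n normrM ger0_norm ?exprn_ge0 //.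
  by rewrite ler_wpM2l ?exprn_ge0.
apply/eqP; apply: contraT; rewrite -normr_gt0 => c1.
have c1M := cM 1%N; move: `|c 1%N| c1 c1M est => w w0 wM est.
(* At s = w/(4M), at most 1/2 because w is at most M, the estimate would read w^2/(4M) <=
   w^2/(8M). *)
have s0 : 0 <= w / (4 * M) by rewrite divr_ge0 ?mulr_ge0 // ltW.
have s1 : w / (4 * M) <= 2^-1 by rewrite ler_pdivrMr ?mulr_gt0 //; lra.
have := est _ s0 s1.
have -> : w / (4 * M) * w = 4 * (w ^+ 2 / (16 * M)) by field; rewrite gt_eqF.
have -> : 2 * M * (w / (4 * M)) ^+ 2 = 2 * (w ^+ 2 / (16 * M)).
  by field; rewrite gt_eqF.
have : 0 < w ^+ 2 / (16 * M) by rewrite divr_gt0 ?exprn_gt0 ?mulr_gt0.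
move: (_ / _) => u u0; rewrite ler_pM2r // ler_nat.
by [].
Qed.

Section LieGroup.
Variables (R : realType) (L : lieAlgType R) (G : topGroupType).
Variables (ex : L -> G) (Ad : G -> 'End(L)).
Hypothesis hG : lie_group ex Ad.
Implicit Types (x y : L) (g : G).

(** For small nonzero s both multiples lie where [ex] is injective. Whole lines are compared because
    [ex] is only locally injective. *)
Lemma exp_line_inj x y : (forall s : R, ex (s *: x) = ex (s *: y)) -> x = y.
Proof.
move=> E; have [U [oU U0 Uinj _]] := lie_group_exp_local_homeo hG.
have nearU (u : 'rV[R]_(dim L)) : \forall s \near (0:R)^', U (s *: u).
  apply: cvg_within.
  have := @scalel_continuous R _ u 0; rewrite /continuous_at scale0r; apply.
  exact: open_nbhs_nbhs.
near (0 : R)^' => s.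
have s0 : s != 0 by near: s; exact: nbhs_dnbhs_neq.
have : s *: v2r x = s *: v2r y.
  apply: Uinj; first by apply: mem_set; near: s; exact: nearU.
    by apply: mem_set; near: s; exact: nearU.
  by rewrite !linearZ /= !v2rK.
by move=> /(scalerI s0)/v2r_inj.
Unshelve. all: by end_near.
Qed.

Lemma AdJ g x : ex (Ad g x) = (g * ex x * g^-1)%g.
Proof. by rewrite (lie_group_AdJ hG). Qed.

Lemma AdM g g' x : Ad (g * g')%g x = Ad g (Ad g' x).
Proof.
apply: exp_line_inj => s; rewrite -!linearZ /= !AdJ.
by rewrite invgM !mulgA.
Qed.

Lemma Ad1 x : Ad 1%g x = x.
Proof. by apply: exp_line_inj => s; rewrite -linearZ AdJ invg1 mulg1 mul1g. Qed.

Lemma AdK g : cancel (Ad g) (Ad g^-1%g).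
Proof. by move=> x; rewrite -AdM mulVg Ad1. Qed.

Lemma AdVK g : cancel (Ad g^-1%g) (Ad g).
Proof. by move=> x; rewrite -AdM mulgV Ad1. Qed.

Lemma Ad_fix g x : (forall s : R, (g * ex (s *: x) = ex (s *: x) * g)%g) -> Ad g x = x.
Proof.
by move=> E; apply: exp_line_inj => s; rewrite -linearZ AdJ E mulgK.
Qed.

Lemma v2rZ (k : R) x j : v2r (k *: x) 0 j = k * v2r x 0 j.
Proof. by rewrite linearZ mxE. Qed.

(** The linear map [f] is applied termwise so that the series can be compared after [Ad g] or
    [theta]. *)
Lemma Ad_exp_cvg (f : 'End(L)) x y j :
  (fun n : nat => \sum_(k < n) (k`!%:R)^-1 * v2r (f (iter k (lie x) y)) 0 j)
    @ \oo --> (v2r (f (Ad (ex x) y)) 0 j : R).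
Proof.
pose S n := \sum_(k < n) (k`!%:R : R)^-1 *: iter k (lie x) y.
have cS i : (fun n : nat => v2r (S n) 0 i) @ \oo --> (v2r (Ad (ex x) y) 0 i : R).
  have cc := @coord_continuous R 1 (dim L) 0 i (v2r (Ad (ex x) y)).
  exact: (cvg_comp _ _ (@lie_group_Ad_exp _ _ _ _ _ hG x y) cc).
have fE u : v2r (f u) 0 j = \sum_i v2r u 0 i * f2mx f i j.
  by rewrite v2r_hom mxE.
rewrite fE (_ : (fun n => _) = (fun n => \sum_i v2r (S n) 0 i * f2mx f i j)).
  apply: cvg_big => [|i _]; first exact: add_continuous.
  exact: cvgMr_tmp.
apply/funext => n; rewrite -fE /S !linear_sum summxE.
by apply: eq_bigr => k _; rewrite !linearZ mxE.
Qed.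

Lemma iter_lieZ (s : R) x y k : iter k (lie (s *: x)) y = s ^+ k *: iter k (lie x) y.
Proof.
elim: k => [|k IH]; first by rewrite expr0 scale1r.
by rewrite !iterS IH lieZl lieZr scalerA exprS.
Qed.

Lemma Ad_lie g : lie_endo (Ad g).
Proof.
move=> x y; apply: v2r_inj; apply/rowP => j; apply/eqP; rewrite -subr_eq0; apply/eqP.
(* The coefficients of a power series in s whose sum is identically 0; the one of index 1 is the
   claim. *)
pose D k := (k`!%:R : R)^-1 * (v2r (Ad g (iter k (lie x) y)) 0 j -
  v2r (iter k (lie (Ad g x)) (Ad g y)) 0 j).
suff : D 1%N = 0 by rewrite /D factS fact0 muln1 invr1 mul1r.
apply: (@pseries_const_coef1 R D 0) => s.
have E : Ad g (Ad (ex (s *: x)) y) = Ad (ex (s *: Ad g x)) (Ad g y).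
  by rewrite -linearZ AdJ -!AdM mulgVK.
rewrite [X in _ --> X](_ : 0 = v2r (Ad g (Ad (ex (s *: x)) y)) 0 j -
    v2r (\1%VF (Ad (ex (s *: Ad g x)) (Ad g y))) 0 j); last by rewrite id_lfunE E subrr.
rewrite (_ : (fun n => _) = (fun n : nat => \sum_(k < n) (k`!%:R)^-1 *
    v2r (Ad g (iter k (lie (s *: x)) y)) 0 j) - (fun n : nat => \sum_(k < n) (k`!%:R)^-1 *
    v2r (\1%VF (iter k (lie (s *: Ad g x)) (Ad g y))) 0 j)).
  by apply: cvgB; exact: Ad_exp_cvg.
apply/funext => n; rewrite fctE -sumrB; apply: eq_bigr => k _.
by rewrite /D !iter_lieZ id_lfunE [Ad g (_ *: _)]linearZ !v2rZ; ring.
Qed.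

(** The bracket is the linear coefficient in s of a constant series. *)
Lemma Ad_exp_fix_lie u z :
  (forall s : R, Ad (ex (s *: u)) z = z) -> lie u z = 0.
Proof.
move=> E; apply: v2r_inj; apply/rowP => j; rewrite linear0 mxE.
pose D k := (k`!%:R : R)^-1 * v2r (iter k (lie u) z) 0 j.
suff : D 1%N = 0 by rewrite /D factS fact0 muln1 invr1 mul1r.
apply: (@pseries_const_coef1 R D (v2r z 0 j)) => s.
rewrite -[in X in _ --> X](E s) -[Ad _ _]id_lfunE.
rewrite (_ : (fun n => _) = (fun n : nat => \sum_(k < n) (k`!%:R)^-1 *
    v2r (\1%VF (iter k (lie (s *: u)) z)) 0 j)); first exact: Ad_exp_cvg.
apply/funext => n; apply: eq_bigr => k _.
by rewrite /D iter_lieZ id_lfunE v2rZ; ring.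
Qed.

Lemma Ad_exp_eigen (q : R) x y : lie x y = q *: y -> Ad (ex x) y = expR q *: y.
Proof.
move=> xy; apply: v2r_inj; apply/rowP => j.
have it k : iter k (lie x) y = q ^+ k *: y.
  elim: k => [|k IH]; first by rewrite expr0 scale1r.
  by rewrite iterS IH lieZr xy scalerA exprSr.
have := @Ad_exp_cvg \1%VF x y j; rewrite id_lfunE => /(@cvg_unique _ (@Rhausdorff R)); apply.
rewrite v2rZ.
rewrite (_ : (fun n => _) = (fun n : nat => series (exp_coeff q) n * v2r y 0 j)).
  by apply: cvgMr_tmp; exact: is_cvg_series_exp_coeff.
apply/funext => n; rewrite /series /= big_mkord mulr_suml; apply: eq_bigr => k _.
by rewrite id_lfunE it v2rZ /exp_coeff /= mulrA [_ / _]mulrC.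
Qed.

Lemma Ad_exp_comm x y : lie x y = 0 -> Ad (ex x) y = y.
Proof.
by move=> xy; rewrite (@Ad_exp_eigen 0) ?scale0r // expR0 scale1r.
Qed.

Lemma exp_comm x y : lie x y = 0 -> (ex x * ex y = ex y * ex x)%g.
Proof.
move=> /Ad_exp_comm E; have := AdJ (ex x) y; rewrite E => exy.
by rewrite [in RHS]exy mulgVK.
Qed.

Variable theta : 'End(L).
Hypothesis thetaL : lie_endo theta.

(** The condition defines a subgroup, so the generators ex(x) with x in k suffice; there theta
    commutes with ad x and thus with its exponential series. *)
Lemma K_group_theta g : K_group ex theta g -> forall y, theta (Ad g y) = Ad g (theta y).
Proof.
suff KB : K_group ex theta `<=` [set g | forall y, theta (Ad g y) = Ad g (theta y)].
  by move=> /KB.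
apply: smallest_sub => [|_ [x /= xk <-] y].
  split=> [y|g1 g2 E1 E2 y|g1 E1 y]; first by rewrite !Ad1.
    by rewrite !AdM E1 E2.
  by apply: (can_inj (AdK g1)); rewrite -E1 !AdVK.
apply: v2r_inj; apply/rowP => j.
have := @Ad_exp_cvg theta x y j => /(@cvg_unique _ (@Rhausdorff R)); apply.
have := @Ad_exp_cvg \1%VF x (theta y) j; rewrite id_lfunE.
have it k : iter k (lie x) (theta y) = theta (iter k (lie x) y).
  by elim: k => //= k ->; rewrite thetaL; move: xk; rewrite mem_k_space => /eqP ->.
by under eq_fun do under eq_bigr do rewrite id_lfunE it.
Qed.

End LieGroup.

(** * Coefficients of r in the algebra R, and invariance under M and W *)

Section Invariance.
Variables (R : realType) (L : lieAlgType R) (G : topGroupType).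
Variables (ex : L -> G) (Ad : G -> 'End(L)).
Hypothesis hG : lie_group ex Ad.
Variables (theta : 'End(L)).
Hypothesis htheta : cartan_involution theta.
Variables (a t : {vspace L}).
Hypothesis ha : maximal_abelian_in a (p_space theta).
Hypothesis ht : maximal_abelian_in t (m_space theta a).
Local Notation LC := (cplx L).
Local Notation C := R[i].
Local Notation H := (cartan a t).
Local Notation m := (m_space theta a).
Local Notation thetaC := (cplx_end theta).
Variables h e : dual H -> LC.
Hypothesis he : root_vectors h e.
Variables (r : nat) (x : r.-tuple L).
Hypothesis hx : orthonormal_basis theta a x.
Variables (d : nat) (c c' : d.-tuple LC).
Hypothesis hc : dual_bases (cplx_sub m) c c'.
Implicit Types (l : dual a).
Local Notation varpi := (varpi (t := t) e).
Local Notation Sigma := (@restricted_roots R L a).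
Local Notation sig := (fset_set Sigma).
Local Notation rr := (r_mx ex e x c c').
Local Notation A := (A_group ex a).

Let thetaL : lie_endo theta. Proof. by case: htheta. Qed.

(** Such a [u] annihilates m, a and all restricted root spaces, so ad u = 0 and [u] is in the
    radical of the Killing form. *)
Lemma restricted_roots_separate u : u \in a ->
  (forall l, restricted_roots l -> l (vsproj a u) = 0) -> u = 0.
Proof.
move=> ua lu; apply: (killing_nondeg htheta) => w.
have adC0 : ad (cplx_of u) = 0.
  apply: (weights_span htheta ha ht he hx hc) => [z zm|z za|l z rl zw]; rewrite adE.
  - by rewrite (a_weight_m zm) // zero_lfunE scale0r.
  - by rewrite (a_weight_a ha za) // zero_lfunE scale0r.
  - by rewrite zw // lu // scale0r.
have -> : killing u w = \tr (f2mx (0 \o ad w : 'End(L))%VF).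
  rewrite /killing; congr (\tr (f2mx (_ \o _)%VF)); apply/lfunP => y.
  have := congr1 (fun f : 'End(LC) => f (cplx_of y)) adC0.
  by rewrite adE zero_lfunE -cplx_of_lie => -[E]; rewrite adE E zero_lfunE.
by rewrite comp_lfun0l linear0 mxtrace0.
Qed.

(* [ex y] determines the eigenvalues exp (l y) of [Ad (ex y)]. *)

Lemma exp_inj_a : {in a &, injective ex}.
Proof.
move=> y y' ya y'a E; apply/eqP; rewrite -subr_eq0; apply/eqP.
apply: restricted_roots_separate; first by rewrite memvB.
move=> l [_ [v [v0 vw]]]; rewrite linearB linearB /=; apply/eqP; rewrite subr_eq0.
have Ew z : z \in a -> Ad (ex z) v = expR (l (vsproj a z)) *: v.
  by move=> za; apply: (Ad_exp_eigen hG); rewrite -vw vsprojK.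
have : (expR (l (vsproj a y)) - expR (l (vsproj a y')) : R) *: v = 0.
  by rewrite scalerBl -!Ew // E subrr.
move=> /eqP; rewrite scaler_eq0 (negPf v0) orbF subr_eq0.
by move=> /eqP/expR_inj ->.
Qed.

Lemma log_A_exp y : y \in a -> log_A ex a (ex y) = y.
Proof.
move=> ya; rewrite /log_A; case: xgetP => [z _ [za zE]|/(_ y)[]//].
exact: exp_inj_a.
Qed.

Lemma exp_a_comm y y' : y \in a -> y' \in a -> (ex y * ex y' = ex y' * ex y)%g.
Proof. by move=> ya y'a; apply: (exp_comm hG); rewrite (abelian_a ha). Qed.

(* [Ad g y] lies in p, and the one-parameter group it generates stays in the
   abelian group A, so [Ad g y] commutes with [a]. *)

Lemma Ad_stable_a g : K_group ex theta g ->
  (forall y, y \in a -> A (g * ex y * g^-1)%g) -> forall y, y \in a -> Ad g y \in a.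
Proof.
move=> Kg gA y ya; apply: (maximal_abelianP ha).
  by rewrite mem_p_space (K_group_theta hG thetaL Kg) (theta_a ha ya) linearN.
move=> z za; rewrite lieC; apply/eqP; rewrite oppr_eq0; apply/eqP.
apply: (Ad_exp_fix_lie hG) => s; apply: (Ad_fix hG) => s'.
rewrite -linearZ (AdJ hG).
have [y' /= y'a <-] := gA _ (memvZ s ya).
by rewrite exp_a_comm // memvZ.
Qed.

Lemma M_group_Ad g y : M_group ex theta a g -> y \in a -> Ad g y = y.
Proof.
move=> [_ gA] ya; apply: (Ad_fix hG) => s; apply: gA.
by exists (s *: y) => //=; rewrite memvZ.
Qed.

Lemma NKA_group_Ad g : NKA_group ex theta a g -> forall y, y \in a -> Ad g y \in a.
Proof.
move=> [Kg gA]; apply: Ad_stable_a => // y ya.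
by rewrite -[A]gA; exists (ex y) => //; exists y.
Qed.

Lemma K_groupV g : K_group ex theta g -> K_group ex theta g^-1%g.
Proof.
by move=> Kg B BX; have [[_ _ BV] _] := BX; apply: BV; exact: Kg.
Qed.

Lemma NKA_groupV_Ad g : NKA_group ex theta a g ->
  forall y, y \in a -> Ad g^-1%g y \in a.
Proof.
move=> [Kg gA]; apply: Ad_stable_a; first exact: K_groupV.
move=> y ya; have : A (ex y) by exists y.
rewrite -{1}gA => -[b bA <-]; rewrite invgK !mulgA mulVg mul1g mulgVK.
exact: bA.
Qed.

Lemma K_group_Ad_theta g y : K_group ex theta g ->
  theta (Ad g^-1%g y) = Ad g^-1%g (theta y).
Proof. by move=> /K_groupV /(K_group_theta hG thetaL). Qed.

Lemma in_R_tensor_M_seq (I : eqType) (s : seq I) (f : I -> A_reg ex a -> C)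
    (T : I -> tensor LC) (F : A_reg ex a -> tensor LC) :
  (forall i, i \in s -> R_algebra (f i) /\ M_invariant ex Ad theta a (T i)) ->
  (forall g : A_reg ex a, F g = \sum_(i <- s) f i g *: T i) ->
  in_R_tensor_M Ad theta F.
Proof.
move=> fT FE; exists (size s), (fun i => f (tnth (in_tuple s) i)),
  (fun i => T (tnth (in_tuple s) i)); split=> [i|i|g].
- by case: (fT (tnth (in_tuple s) i)) => //; exact: mem_tnth.
- by case: (fT (tnth (in_tuple s) i)) => //; exact: mem_tnth.
- by rewrite FE big_tnth.
Qed.

Lemma r_mx_in_R_tensor_M : in_R_tensor_M Ad theta (fun g : A_reg ex a => rr (val g)).
Proof.
(* The index [None] carries the constant part of r, [Some l] the summand of the restricted root
   l. *)
pose f (o : option (dual a)) (g : A_reg ex a) : C :=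
  if o is Some l then (1 - xi ex (- (l *+ 2)) (val g))^-1 else 1.
pose T o := if o is Some l then - varpi l
  else - (2^-1 *: varpi_m c c') - 2^-1 *: sum_xx x.
apply: (@in_R_tensor_M_seq _ (None :: map Some sig) f T) => [i|g]; last first.
  rewrite (r_mxE ex htheta ha) big_cons big_map /= scale1r; congr (_ + _).
  by rewrite -sumrN; apply: eq_bigr => l _; rewrite scalerN.
move=> i_s; split.
  case: i i_s => [l|_]; last by move=> S [[S1 _ _] _].
  rewrite inE => /mapP[l' ls [->]] {l}.
  have rl := restricted_root_opp htheta ha (mem_sig htheta ha ls).
  move: l' rl {ls} => l rl S [[_ _ SM] SG].
  (* 1 - xi_(-2l) = (1 + xi_(-l))(1 - xi_(-l)), so the coefficient is a product of two
     generators. *)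
  have -> : f (Some l) = (fun g : A_reg ex a =>
      (1 + xi ex (- l) (val g))^-1 * (1 - xi ex (- l) (val g))^-1).
    apply/funext => g; rewrite /f -invfM -mulNrn mulr2n xiD; congr (_^-1); ring.
  by apply: SM; apply: SG; exists (- l) => //; [left|right].
move=> g Mg; have [Kg _] := Mg.
(* M acts trivially on a, so the pullback fixes every restricted root and each [varpi] is invariant
   by itself. *)
have fa y : y \in a -> Ad g y \in a by move=> ya; rewrite (M_group_Ad Mg).
have fVa y : y \in a -> Ad g^-1%g y \in a.
  by move=> ya; rewrite -(M_group_Ad Mg ya) (AdK hG).
have gth y : theta (Ad g^-1%g y) = Ad g^-1%g (theta y) by exact: K_group_Ad_theta.
rewrite /Ad_tensor; case: i i_s => [l|_] /=.
  rewrite inE => /mapP[l' /(mem_sig htheta ha) rl [->]]; rewrite linearN /= {l}.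
  rewrite (varpi_aut htheta ha ht he hx hc (Ad_lie hG _)
    (Ad_lie hG _) (AdK hG g) (AdVK hG g) fa fVa) //.
  congr (- varpi _); apply: dual_ext => y ya.
  by rewrite dual_pullE // -{1}(M_group_Ad Mg ya) (AdK hG).
rewrite linearB linearN !linearZ /=.
rewrite (varpi_m_aut htheta ha ht he hx hc (Ad_lie hG _)
  (Ad_lie hG _) (AdK hG g) (AdVK hG g) fa fVa gth).
by rewrite (sum_xx_aut htheta ha ht he hx hc (Ad_lie hG _)
  (Ad_lie hG _) (AdK hG g) (AdVK hG g) fa fVa gth).
Qed.

Lemma r_mx_W_invariant : W_invariant Ad theta (fun g : A_reg ex a => rr (val g)).
Proof.
move=> w Nw g g' gg'; have [Kw _] := Nw.
have fa := NKA_group_Ad Nw; have fVa := NKA_groupV_Ad Nw.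
have gth y : theta (Ad w^-1%g y) = Ad w^-1%g (theta y) by exact: K_group_Ad_theta.
(* The logarithm of w g w^-1 is Ad(w) applied to the logarithm of g. *)
have xiE l : xi ex l (val g') = xi ex (dual_pull (Ad w) l) (val g).
  have [[y /= ya yE] _] := set_valP g.
  rewrite -[sval g]/(val g) in yE *.
  rewrite gg' -yE -(AdJ hG) /xi !log_A_exp ?fa //.
  by rewrite dual_pullE.
rewrite /Ad_tensor !(r_mxE ex htheta ha) !linearB linearN !linearZ /=.
rewrite (varpi_m_aut htheta ha ht he hx hc (Ad_lie hG _)
  (Ad_lie hG _) (AdK hG w) (AdVK hG w) fa fVa gth).
rewrite (sum_xx_aut htheta ha ht he hx hc (Ad_lie hG _)
  (Ad_lie hG _) (AdK hG w) (AdVK hG w) fa fVa gth).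
congr (_ - _).
have pK := dual_pullK (AdVK hG w) fVa.
rewrite linear_sum /=.
(* Ad(w) sends [varpi l] to the [varpi] of l o Ad(w^-1); replacing l by l o Ad(w) restores [varpi l]
   and turns the coefficients at g into those at w g w^-1. *)
rewrite [RHS](sig_reindex htheta ha _ (f := dual_pull (Ad w))); last first.
- move=> l; exact: (restricted_root_aut (Ad_lie hG _) (AdVK hG w) (AdK hG w)).
- exact: can_inj pK.
rewrite big_seq [RHS]big_seq; apply: eq_bigr => l /(mem_sig htheta ha) rl.
rewrite linearZ /=.
rewrite (varpi_aut htheta ha ht he hx hc (Ad_lie hG _)
  (Ad_lie hG _) (AdK hG w) (AdVK hG w) fa fVa); last first.
  exact: (restricted_root_aut (Ad_lie hG _) (AdVK hG w) (AdK hG w)).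
by rewrite pK xiE dual_pullN mulr2n dual_pullD.
Qed.

End Invariance.

Theorem proposition6p10
  (R : realType) (L : lieAlgType R) (G : topGroupType)
  (ex : L -> G) (Ad : G -> 'End(L))
  (hG : lie_group ex Ad) (hconn : connected [set: G])
  (hss : semisimple L) (hcenter : finite_set (group_center G))
  (theta : 'End(L)) (htheta : cartan_involution theta)
  (a : {vspace L}) (ha : maximal_abelian_in a (p_space theta))
  (r : nat) (x : r.-tuple L) (hx : orthonormal_basis theta a x)
  (t : {vspace L}) (ht : maximal_abelian_in t (m_space theta a))
  (h e : dual (cartan a t) -> cplx L) (he : root_vectors h e)
  (tl : dual a -> cplx L) (htl : coroot_vectors tl)
  (n : nat) (b b' : n.-tuple (cplx L)) (hb : dual_bases fullv b b')
  (d : nat) (c c' : d.-tuple (cplx L))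
  (hc : dual_bases (cplx_sub (m_space theta a)) c c')
  (U : algType R[i]) (iU : {linear cplx L -> U})
  (hU : universal_enveloping iU) :
  let thetaC := cplx_end theta in
  let Sigma := @restricted_roots R L a in
  let rr := r_mx ex e x c c' in
  let id_theta_r21 g := tens_map \1%VF thetaC (tens_swap (rr g)) in
  [/\ forall g, A_reg ex a g -> r_plus ex theta e c c' g = rr g + id_theta_r21 g,
      forall g, A_reg ex a g -> r_minus ex theta e x g = - rr g + id_theta_r21 g,
      forall g, A_reg ex a g ->
        kappa_core ex theta e c c' b b' iU g =
        mult_map iU (id_theta_r21 g) +
        4^-1 *: \sum_(l \in Sigma)
          ((1 + xi ex (l *+ 2) g) / (1 - xi ex (l *+ 2) g) * (mtp t l)%:R)
            *: iU (tl l),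
      in_R_tensor_M Ad theta (fun g : A_reg ex a => rr (val g)) /\
      W_invariant Ad theta (fun g : A_reg ex a => rr (val g))
    & forall g, A_reg ex a g -> id_theta_r21 g = tens_map thetaC \1%VF (rr g)].
Proof.
have iL : lie_to_alg iU by case: hU.
move=> thetaC Sigma rr id_theta_r21; split.
- by move=> g _; exact: (r_plusE ex htheta ha ht he hx hc).
- by move=> g _; exact: (r_minusE ex htheta ha ht he hx hc).
- by move=> g gA; exact: (kappa_coreE htheta ha ht he hx hc hb iL htl gA).
- split; first exact: (r_mx_in_R_tensor_M hG htheta ha ht he hx hc).
  exact: (r_mx_W_invariant hG htheta ha ht he hx hc).
- by move=> g _; exact: (theta_r_mx_swap ex htheta ha ht he hx hc).
Qed.
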